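(* In the estimating-equation setting described in the context (integers $p_n\to\infty$; probability measures $\mathbf P_{n,\sigma}$, $\sigma>0$; i.i.d. observations $\chi^n_1,\dots,\chi^n_{p_n}$; auxiliary variables $(S_n,Q_n)$ independent of the observations; functions $f_{n,s,q}$ and $H_{n,s}$; estimators $\widehat\sigma_n(s,q)$; functions $F_{n,s,q}$, $F^{(2)}_{n,s,q}$), assume the following. (A1) If $\sigma_n\to\sigma>0$, then $S_n\to\sigma$ in $\mathbf P_{n,\sigma_n}$-probability. (A2) If $\sigma_n\to\sigma>0$, then the sequence of laws of $Q_n$ under $\mathbf P_{n,\sigma_n}$ is tight. (B1) $\sup_{n\ge1,\,s>0,\,q\in\mathbb R}\|f_{n,s,q}\|^4/p_n<\infty$, where $\|\cdot\|$ is the sup-norm. (B2) Each $H_{n,s}$ is continuously differentiable on $(0,\infty)$. (B3) For every $s>0$ there is a differentiable function $\overline F_s$ on $(0,\infty)$ such that, whenever $s_n\to s$, $H_{n,s_n}$ and $H'_{n,s_n}$ converge locally uniformly on $(0,\infty)$ to $\overline F_s$ and $\overline F_s'$ respectively. (B4) $\overline F_s'(s)\neq0$ for all $s>0$. (B5) There is a function $F^{(2)}$ on $(0,\infty)$ such that $F^{(2)}_{n,s_n,q_n}(u_n)\to F^{(2)}(u)$ for any two sequences $u_n,s_n$ converging to the same limit $u>0$ and any bounded sequence $q_n$. (B6) There is a sequence $w_n\to+\infty$ such that $\sup_n w_n\,|F_{n,s_n,q_n}(u_n)-H_{n,s_n}(u_n)|<\infty$ for any two sequences $u_n,s_n$ converging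 to the same limit $u>0$ and any bounded sequence $q_n$. Then: a) The sequence $(w_n\wedge\sqrt{p_n})\,(\widehat\sigma_n(S_n,Q_n)-\sigma)$ is tight under $\mathbf P_{n,\sigma}$, uniformly in $n$ and in $\sigma$ in any compact subset of $(0,\infty)$. b) If $w_n/\sqrt{p_n}\to\infty$, then $\sqrt{p_n}\,(\widehat\sigma_n(S_n,Q_n)-\sigma)$ converges in law under $\mathbf P_{n,\sigma}$, uniformly in $\sigma$ in any compact subset of $(0,\infty)$, to the centered normal distribution with variance $$\Xi^2(\sigma)=\frac{F^{(2)}(\sigma)-\overline F_\sigma(\sigma)^2}{\overline F_\sigma'(\sigma)^2}.$$
   Context: Setting. For each $n\ge1$ let $p_n\ge1$ be an integer, with $p_n\to\infty$. For each $n$ there is a family of probability measures $(\mathbf P_{n,\sigma})_{\sigma>0}$ (expectation $\mathbf E_{n,\sigma}$) and real random variables $\chi^n_1,\dots,\chi^n_{p_n}$, $S_n>0$, $Q_n\in\mathbb R$ such that, under each $\mathbf P_{n,\sigma}$, the $\chi^n_i$ are i.i.d. and the family $(S_n,Q_n)$ is independent of the family $(\chi^n_i:1\le i\le p_n)$. For $s>0$, $q\in\mathbb R$ there are given real functions $f_{n,s,q}$ on $\mathbb R$ and $H_{n,s}$ on $(0,\infty)$ (with $(x,s,q)\mapsto f_{n,s,q}(x)$ and $(s,u)\mapsto H_{n,s}(u)$ measurable). Put $$U_{n,s,q}(u)=\frac1{p_n}\sum_{i=1}^{p_n}\big(f_{n,s,q}(\chi^n_i)-H_{n,s}(u)\big),\quad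 u>0,$$ and define $\widehat\sigma_n(s,q)$ to be the $u>0$ with $U_{n,s,q}(u)=0$ which is closest to $s$ if it exists (the smaller one if there are two closest solutions), and $\widehat\sigma_n(s,q)=1$ otherwise. Also $$F_{n,s,q}(\sigma)=\mathbf E_{n,\sigma}(f_{n,s,q}(\chi^n_i)),\qquad F^{(2)}_{n,s,q}(\sigma)=\mathbf E_{n,\sigma}(f_{n,s,q}(\chi^n_i)^2).$$ Meaning of uniformity. Uniform tightness in (a) means: for every sequence $\sigma_n\to\sigma>0$, the sequence of laws of $(w_n\wedge\sqrt{p_n})(\widehat\sigma_n(S_n,Q_n)-\sigma_n)$ under $\mathbf P_{n,\sigma_n}$ is tight. Uniform convergence in law in (b) means: for every sequence $\sigma_n\to\sigma>0$, the laws of $\sqrt{p_n}(\widehat\sigma_n(S_n,Q_n)-\sigma_n)$ under $\mathbf P_{n,\sigma_n}$ converge weakly to $\mathcal N(0,\Xi^2(\sigma))$. A normal law with variance $0$ is the Dirac mass at $0$. *)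

(* Defs.v *)
(* Sequences indexed by n >= 1 are indexed here by n : nat, so that the index
   0 stands for the first term; no hypothesis or conclusion depends on the
   value of the index. *)
From HB Require Import structures.
From mathcomp Require Import all_boot all_order all_algebra.
From mathcomp Require Import all_classical all_reals all_analysis.

Set Implicit Arguments.
Unset Strict Implicit.
Unset Printing Implicit Defensive.

Import Order.TTheory GRing.Theory Num.Theory.
Import numFieldNormedType.Exports.

Local Open Scope classical_set_scope.
Local Open Scope ring_scope.

Definition mutually_independent (R : realType) (d : measure_display)
    (T : measurableType d) (P : probability T R) (m : nat)
    (X : 'I_m -> T -> R) : Prop :=
  forall (J : {set 'I_m}) (B : 'I_m -> set R),
    (forall i, measurable (B i)) ->
    P (\bigcap_(i in [set` J]) (X i @^-1` B i)) =
    (\prod_(i in J) P (X i @^-1` B i))%E.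

Definition identically_distributed (R : realType) (d : measure_display)
    (T : measurableType d) (P : probability T R) (m : nat)
    (X : 'I_m -> T -> R) : Prop :=
  forall (i j : 'I_m) (B : set R), measurable B ->
    P (X i @^-1` B) = P (X j @^-1` B).

(* Independence of the sigma-algebras generated by (S, Q) and by the family X. *)
Definition independent_pair_family (R : realType) (d : measure_display)
    (T : measurableType d) (P : probability T R) (m : nat)
    (S Q : T -> R) (X : 'I_m -> T -> R) : Prop :=
  forall A B : set T, g_sigma_preimageU S Q A -> g_sigma_preimage X B ->
    P (A `&` B) = (P A * P B)%E.

(* Sequences in (0, oo) with a limit in (0, oo): parameters and arguments range
   over (0, oo) only, so every term has to be positive. *)
Definition cvg_pos (R : realType) (u : nat -> R) (l : R) : Prop :=
  [/\ forall n, 0 < u n, 0 < l & u @ \oo --> l].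

(* The measures of a non-measurable set being meaningless, having a law
   includes being a random variable. *)
Definition tight_laws (R : realType) (d : nat -> measure_display)
    (T : forall n, measurableType (d n)) (P : forall n, probability (T n) R)
    (X : forall n, T n -> R) : Prop :=
  (forall n, measurable_fun [set: T n] (X n)) /\
  forall e : R, 0 < e -> exists K : set R, compact K /\
    forall n, (P n (X n @^-1` (~` K)) <= e%:E)%E.

Definition cvg_in_law (R : realType) (d : nat -> measure_display)
    (T : forall n, measurableType (d n)) (P : forall n, probability (T n) R)
    (X : forall n, T n -> R)
    (nu : probability (measurableTypeR R) R) : Prop :=
  (forall n, measurable_fun [set: T n] (X n)) /\
  forall h : R -> R, continuous h -> bounded_fun h ->
    ('E_(P n)[h \o X n])%E @[n --> \oo] --> ('E_nu[h])%E.

Definition cvg_in_probability (R : realType) (d : nat -> measure_display)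
    (T : forall n, measurableType (d n)) (P : forall n, probability (T n) R)
    (X : forall n, T n -> R) (l : R) : Prop :=
  forall e : R, 0 < e ->
    P n [set w | e < `|X n w - l|] @[n --> \oo] --> 0%E.

(* normal_prob is parametrised by the standard deviation, and normal_prob 0 0
   is a uniform law, so variance 0 has to be treated apart. *)
Definition centered_normal (R : realType) (v : R) :
    probability (measurableTypeR R) R :=
  if v == 0 then (\d_(0 : measurableTypeR R) : probability _ R)
  else (normal_prob 0 (Num.sqrt v) : probability _ R).

Definition supnorm (R : realType) (g : R -> R) : \bar R :=
  ereal_sup [set (`|g x|)%:E | x in [set: R]].

Definition locally_uniform_cvg (R : realType) (g : nat -> R -> R) (h : R -> R)
    : Prop :=
  forall u : R, 0 < u -> exists V : set R,
    [/\ nbhs u V, V `<=` [set x | 0 < x] & {uniform V, g @ \oo --> h}].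

(* (s, q) |-> U_{s,q}, for given functions f_{s,q} and H_s; w is the point of
   the probability space at which the observations chi are taken. *)
Definition estimating_fun (R : realType) (T : Type) (m : nat)
    (chi : 'I_m -> T -> R) (f : R -> R -> R -> R) (H : R -> R -> R)
    (s q : R) (w : T) (u : R) : R :=
  m%:R^-1 * \sum_(i < m) (f s q (chi i w) - H s u).

Definition closest_zero (R : realType) (U : R -> R) (s : R) : set R :=
  [set u | [/\ 0 < u, U u = 0 &
    forall v, 0 < v -> U v = 0 ->
      `|u - s| < `|v - s| \/ (`|u - s| = `|v - s| /\ u <= v)]].

(* closest_zero U s has at most one element, so xget involves no choice. *)
Definition sigma_hat (R : realType) (T : Type) (m : nat)
    (chi : 'I_m -> T -> R) (f : R -> R -> R -> R) (H : R -> R -> R)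
    (s q : R) (w : T) : R :=
  xget 1 (closest_zero (estimating_fun chi f H s q w) s).

(* E(g(chi_i)); the observations being identically distributed, i is taken to
   be the first index. *)
Definition obs_mean (R : realType) (d : measure_display)
    (T : measurableType d) (P : probability T R) (m : nat) (m0 : (0 < m)%N)
    (chi : 'I_m -> T -> R) (g : R -> R) : R :=
  fine ('E_P[g \o chi (Ordinal m0)])%E.

(* Main.v *)
(* Everything is reduced to deterministic sequences s_n -> sigma, q_n bounded:
   by Fubini, an expectation involving (S_n, Q_n) is the integral of the
   corresponding expectations at fixed (s, q), and since S_n -> sigma in
   probability and Q_n is tight, convergence along all such sequences passes to
   the integral.

   For fixed (s_n, q_n), H_n' is close to D = Fbar_sigma'(sigma) <> 0 near sigma,
   so as soon as the empirical mean of f_n is close to H_n(sigma_n) there is a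
   zero near sigma, the closest zero is also near sigma, and the mean value
   theorem gives
     sigma_hat - sigma_n = (mean - H_n(sigma_n)) / D * (1 + o(1)).
   The right-hand side is a centered normalized sum plus the bias controlled by
   (B6): Chebyshev's inequality gives tightness.  Since |f_n| = O(p_n^(1/4)), the
   summands of the normalized sum are uniformly small, and Stein's method gives
   its convergence to the normal law. *)
Require Import Defs.
From HB Require Import structures.
From mathcomp Require Import all_boot all_order all_algebra.
From mathcomp Require Import all_classical all_reals all_analysis.
From mathcomp Require Import measurable_realfun.
From mathcomp Require Import ring lra.

Set Implicit Arguments.
Unset Strict Implicit.
Unset Printing Implicit Defensive.

Import Order.TTheory GRing.Theory Num.Theory.
Import numFieldNormedType.Exports.

Local Open Scope classical_set_scope.
Local Open Scope ring_scope.

(** * Bounded random variables and independence *)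

(** (B4) gives a nonzero slope only near sigma, so the estimating function may have further zeros
    elsewhere. The choice of the zero closest to S_n is what rules them out: S_n and sigma_n have
    the same limit, so a zero found near sigma_n bounds the distance from S_n to the selected one.

    The estimator is a selection among the zeros of a random function. That it is a random variable
    belongs to both conclusions, and the Fubini step even needs measurability jointly in s, q and
    the observations. It comes from writing the events where the closest zero exceeds c through
    countably many conditions on zeros in compact segments.

    The passage from fixed to random parameters acts on expectations of uniformly bounded functions.
    Convergence in law has this form already; tightness is brought into it as P(|X_n| > k_n) -> 0
    for every sequence of integers k_n -> oo, the test functions being allowed to vary with n.

    The limit variance may be 0. Stein's equation degenerates there, and convergence of second
    moments to 0 takes its place. *)

Lemma measurable_set_ltr d (T : measurableType d) (R : realType)
    (f g : T -> R) : measurable_fun [set: T] f -> measurable_fun [set: T] g ->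
  measurable [set x | f x < g x].
Proof.
move=> mf mg; have := measurable_fun_ltr mf mg.
by move=> /(_ measurableT [set true] I); rewrite setTI.
Qed.

(** Every function integrated against a probability below is bounded, so this one predicate, stable
    under the algebraic operations, supplies all integrability conditions. *)
Definition bounded_rv d (T : measurableType d) (R : realType) (X : T -> R) :=
  measurable_fun [set: T] X /\ exists B, forall w, `|X w| <= B.

Section bounded_rv_theory.
Context d (T : measurableType d) (R : realType).
Implicit Types X Y : T -> R.

Lemma bounded_rvW (B : R) X :
  measurable_fun [set: T] X -> (forall w, `|X w| <= B) -> bounded_rv X.
Proof. by move=> mX XB; split=> //; exists B. Qed.

Lemma bounded_rv_bound X :
  bounded_rv X -> exists B, 0 < B /\ forall w, `|X w| <= B.
Proof.
move=> [_ [B XB]]; exists (`|B| + 1); split; first by rewrite ltr_wpDl.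
by move=> w; rewrite (le_trans (XB w))// (le_trans (ler_norm _))// lerDl.
Qed.

Lemma bounded_rv_cst (c : R) : bounded_rv (fun _ : T => c).
Proof. by apply: (@bounded_rvW `|c|); [exact: measurable_cst|]. Qed.

Lemma bounded_rvD X Y :
  bounded_rv X -> bounded_rv Y -> bounded_rv (fun w => X w + Y w).
Proof.
move=> [mX [A XA]] [mY [B YB]]; apply: (@bounded_rvW (A + B)).
  exact: measurable_funD.
by move=> w; rewrite (le_trans (ler_normD _ _))// lerD.
Qed.

Lemma bounded_rvN X : bounded_rv X -> bounded_rv (fun w => - X w).
Proof.
move=> [mX [A XA]]; apply: (@bounded_rvW A); last by move=> w; rewrite normrN.
exact: measurableT_comp.
Qed.

Lemma bounded_rvB X Y :
  bounded_rv X -> bounded_rv Y -> bounded_rv (fun w => X w - Y w).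
Proof. by move=> bX bY; apply: bounded_rvD => //; exact: bounded_rvN. Qed.

Lemma bounded_rvM X Y :
  bounded_rv X -> bounded_rv Y -> bounded_rv (fun w => X w * Y w).
Proof.
move=> [mX [A XA]] [mY [B YB]]; apply: (@bounded_rvW (A * B)).
  exact: measurable_funM.
by move=> w; rewrite normrM ler_pM.
Qed.

Lemma bounded_rvX X n : bounded_rv X -> bounded_rv (fun w => X w ^+ n).
Proof.
move=> bX; elim: n => [|n IH].
  by under eq_fun do rewrite expr0; exact: bounded_rv_cst.
by under eq_fun do rewrite exprS; exact: bounded_rvM.
Qed.

Lemma bounded_rv_norm X : bounded_rv X -> bounded_rv (fun w => `|X w|).
Proof.
move=> [mX [A XA]]; apply: (@bounded_rvW A); last by move=> w; rewrite normr_id.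
exact: measurableT_comp.
Qed.

Lemma bounded_rv_sum (I : finType) (Q : pred I) (X : I -> T -> R) :
  (forall i, bounded_rv (X i)) -> bounded_rv (fun w => \sum_(i | Q i) X i w).
Proof.
move=> bX; elim: (index_enum I) => [|i s IH].
  by under eq_fun do rewrite big_nil; exact: bounded_rv_cst.
under eq_fun do rewrite big_cons.
by case: (Q i) => //; exact: bounded_rvD.
Qed.

Lemma bounded_rv_comp (k : R -> R) X (B : R) :
  measurable_fun [set: R] k -> (forall x, `|k x| <= B) ->
  measurable_fun [set: T] X -> bounded_rv (fun w => k (X w)).
Proof.
by move=> mk kB mX; apply: (@bounded_rvW B) => //; exact: measurableT_comp.
Qed.

End bounded_rv_theory.

Section expectation_bounded.
Context d (T : measurableType d) (R : realType) (P : probability T R).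
Implicit Types X Y : T -> R.

Lemma bounded_rv_integrable X : bounded_rv X ->
  P.-integrable [set: T] (EFin \o X).
Proof.
move=> [mX [B XB]]; apply: measurable_bounded_integrable => //.
  by rewrite (le_lt_trans (probability_le1 _ _))// ltry.
exists B; split; first by rewrite num_real.
by move=> x Bx w _ /=; rewrite (le_trans (XB w))// ltW.
Qed.
#[local] Hint Resolve bounded_rv_integrable : core.

Lemma RexpE X : bounded_rv X -> ('E_P[X] = (\int[P]_w X w)%:E)%E.
Proof.
move=> bX; rewrite unlock /Rintegral fineK//.
by apply: integrable_fin_num => //; exact: bounded_rv_integrable.
Qed.

Lemma fine_expectation X : fine ('E_P[X])%E = \int[P]_w X w.
Proof. by rewrite unlock. Qed.

Lemma Rexp_cst (c : R) : \int[P]_w c = c.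
Proof. by rewrite Rintegral_cst//= (probability_setT P) mulr1. Qed.

Lemma RexpD X Y : bounded_rv X -> bounded_rv Y ->
  \int[P]_w (X w + Y w) = \int[P]_w X w + \int[P]_w Y w.
Proof. by move=> bX bY; rewrite RintegralD//; exact: bounded_rv_integrable. Qed.

Lemma RexpB X Y : bounded_rv X -> bounded_rv Y ->
  \int[P]_w (X w - Y w) = \int[P]_w X w - \int[P]_w Y w.
Proof. by move=> bX bY; rewrite RintegralB//; exact: bounded_rv_integrable. Qed.

Lemma RexpZ (c : R) X : bounded_rv X ->
  \int[P]_w (c * X w) = c * \int[P]_w X w.
Proof. by move=> bX; rewrite RintegralZl//; exact: bounded_rv_integrable. Qed.

Lemma Rexp_sum (I : finType) (Q : pred I) (X : I -> T -> R) :
  (forall i, bounded_rv (X i)) ->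
  \int[P]_w (\sum_(i | Q i) X i w) = \sum_(i | Q i) \int[P]_w X i w.
Proof.
move=> bX.
suff [_ ->] : bounded_rv (fun w => \sum_(i | Q i) X i w) /\
  \int[P]_w (\sum_(i | Q i) X i w) = \sum_(i | Q i) \int[P]_w X i w by [].
elim: (index_enum I) => [|i s [bs IH]].
  rewrite big_nil; under eq_Rintegral do rewrite big_nil.
  by rewrite Rexp_cst; split=> //; under eq_fun do rewrite big_nil;
     exact: bounded_rv_cst.
rewrite big_cons; under eq_Rintegral do rewrite big_cons.
under eq_fun do rewrite big_cons.
case: (Q i) => //; split; first exact: bounded_rvD.
by rewrite RexpD// IH.
Qed.

Lemma le_Rexp X Y : bounded_rv X -> bounded_rv Y -> (forall w, X w <= Y w) ->
  \int[P]_w X w <= \int[P]_w Y w.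
Proof.
by move=> bX bY XY; apply: le_Rintegral => //; exact: bounded_rv_integrable.
Qed.

Lemma le_norm_Rexp X Y : bounded_rv X -> bounded_rv Y ->
  (forall w, `|X w| <= Y w) -> `|\int[P]_w X w| <= \int[P]_w Y w.
Proof.
move=> bX bY XY; rewrite (le_trans (le_normr_Rintegral _ _))//.
  exact: bounded_rv_integrable.
by apply: le_Rexp => //; exact: bounded_rv_norm.
Qed.

Lemma le_norm_Rexp_cst X (B : R) : bounded_rv X ->
  (forall w, `|X w| <= B) -> `|\int[P]_w X w| <= B.
Proof.
move=> bX XB; rewrite -[leRHS]Rexp_cst; apply: le_norm_Rexp => //.
exact: bounded_rv_cst.
Qed.

End expectation_bounded.

Lemma Rintegral_distribution d (T : measurableType d) (R : realType)
    (P : probability T R) d' (T' : measurableType d') (X : {RV P >-> T'})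
    (K : T' -> R) :
  bounded_rv K -> \int[distribution P X]_y K y = \int[P]_w K (X w).
Proof.
move=> [mK [B KB]]; rewrite /Rintegral integral_distribution//.
  exact/measurable_EFinP.
apply: (@bounded_rv_integrable _ _ _ P (K \o X)).
by apply: (@bounded_rvW _ _ _ B) => //=; exact: measurableT_comp.
Qed.

(** * Fubini's theorem for independent variables *)

Section independence.
Context d (T : measurableType d) (R : realType) (P : probability T R).
Context d1 d2 (T1 : measurableType d1) (T2 : measurableType d2).
Variables (X : T -> T1) (Y : T -> T2).
Hypotheses (mX : measurable_fun [set: T] X) (mY : measurable_fun [set: T] Y).
Hypothesis indepXY : forall A B, measurable A -> measurable B ->
  P (X @^-1` A `&` Y @^-1` B) = (P (X @^-1` A) * P (Y @^-1` B))%E.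

HB.instance Definition _ := @isMeasurableFun.Build _ _ _ _ X mX.
HB.instance Definition _ := @isMeasurableFun.Build _ _ _ _ Y mY.
Let XY w := (X w, Y w).
Let mXY : measurable_fun [set: T] XY.
Proof. exact: measurable_fun_pair. Qed.
HB.instance Definition _ := @isMeasurableFun.Build _ _ _ _ XY mXY.

Let PX := distribution P (X : {RV P >-> T1}).
Let PY := distribution P (Y : {RV P >-> T2}).
Let PXY := distribution P (XY : {RV P >-> (T1 * T2)%type}).

Let bounded_rv_xsection (K : T1 * T2 -> R) x :
  bounded_rv K -> bounded_rv (fun y => K (x, y)).
Proof.
move=> [mK [B KB]]; apply: (@bounded_rvW _ _ _ B) => //.
by apply: measurableT_comp => //; exact: measurable_fun_pair.
Qed.

Let Rintegral_Y (K : T2 -> R) : bounded_rv K ->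
  \int[PY]_y K y = \int[P]_w K (Y w).
Proof.
exact: (@Rintegral_distribution _ _ _ P _ _ (Y : {RV P >-> T2})).
Qed.

Lemma bounded_rv_partial (K : T1 * T2 -> R) : bounded_rv K ->
  bounded_rv (fun x => \int[P]_w K (x, Y w)).
Proof.
move=> bK; have [mK [B KB]] := bK.
apply: (@bounded_rvW _ _ _ B); last first.
  move=> x; apply: le_norm_Rexp_cst => //.
  apply: (@bounded_rvW _ _ _ B) => //.
  by apply: measurableT_comp => //; exact: measurable_fun_pair.
have -> : (fun x => \int[P]_w K (x, Y w)) =
    fine \o fubini_F PY (EFin \o K).
  apply/funext => x /=.
  by rewrite -(Rintegral_Y (bounded_rv_xsection x bK)).
apply: measurableT_comp => //.
apply: (@measurable_fubini_F _ _ _ _ _ PX PY).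
exact: (bounded_rv_integrable (PX \x PY)%E).
Qed.

(** Independence says that the joint law agrees on rectangles with the product of the marginal laws,
    hence everywhere; Fubini's theorem then applies. General target spaces are allowed because [X]
    will be the pair (S, Q) and [Y] the tuple of all observations. *)
Lemma Rexp_indep (K : T1 * T2 -> R) : bounded_rv K ->
  \int[P]_w K (X w, Y w) = \int[P]_w \int[P]_w' K (X w, Y w').
Proof.
move=> bK; have [mK [B KB]] := bK.
have e A : measurable A -> (PX \x PY)%E A = PXY A.
  apply: product_measure_unique => A1 A2 mA1 mA2.
  exact: indepXY.
rewrite [LHS](_ : _ = \int[PXY]_z K z); last first.
  by rewrite (@Rintegral_distribution _ _ _ P _ _ (XY : {RV P >-> (T1 * T2)%type})).
rewrite [LHS](_ : _ = \int[(PX \x PY)%E]_z K z); last first.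
  by congr fine; apply: eq_measure_integral => A mA _; exact/esym/e.
transitivity (\int[PX]_x \int[P]_w K (x, Y w)); last first.
  exact: (@Rintegral_distribution _ _ _ P _ _ (X : {RV P >-> T1})
    _ (bounded_rv_partial bK)).
rewrite [LHS]/Rintegral -integral12_prod_meas1; last first.
  exact: (bounded_rv_integrable (PX \x PY)%E).
congr fine; apply: eq_integral => x _.
rewrite -(Rintegral_Y (bounded_rv_xsection x bK)) /fubini_F /Rintegral fineK//.
apply: integrable_fin_num => //.
exact: (bounded_rv_integrable PY (bounded_rv_xsection x bK)).
Qed.

End independence.

Definition independent_rv d (T : measurableType d) (R : realType)
    (P : probability T R) (X Y : T -> R) :=
  forall A B, measurable A -> measurable B ->
    P (X @^-1` A `&` Y @^-1` B) = (P (X @^-1` A) * P (Y @^-1` B))%E.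

Lemma independent_rv_comp d (T : measurableType d) (R : realType)
    (P : probability T R) (X Y : T -> R) (a b : R -> R) :
  measurable_fun [set: R] a -> measurable_fun [set: R] b ->
  independent_rv P X Y -> independent_rv P (a \o X) (b \o Y).
Proof.
move=> ma mb iXY A B mA mB; apply: (iXY (a @^-1` A) (b @^-1` B)).
  by rewrite -[X in measurable X]setTI; exact: ma.
by rewrite -[X in measurable X]setTI; exact: mb.
Qed.

Lemma Rexp_indepM d (T : measurableType d) (R : realType)
    (P : probability T R) (X Y : T -> R) :
  bounded_rv X -> bounded_rv Y -> independent_rv P X Y ->
  \int[P]_w (X w * Y w) = (\int[P]_w X w) * (\int[P]_w Y w).
Proof.
move=> bX bY iXY.
have [A [A0 XA]] := bounded_rv_bound bX.
have [B [B0 YB]] := bounded_rv_bound bY.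
(* The product is unbounded on the plane. Clamping each factor at a bound of its variable changes
   nothing on the ranges of [X] and [Y] and makes the kernel bounded. *)
pose clamp (c x : R) := Num.max (- c) (Num.min c x).
have clampE c x : `|x| <= c -> clamp c x = x.
  rewrite ler_norml => /andP[h1 h2].
  by rewrite /clamp; move/min_idPr : h2 => ->; exact/max_idPr.
have clampB c x : 0 < c -> `|clamp c x| <= c.
  move=> c0; rewrite ler_norml /clamp le_max lexx/= ge_max ge_min lexx/=.
  by rewrite andbT ge0_cp ?ltW.
have bclamp c : 0 < c -> bounded_rv (clamp c).
  move=> c0; apply: (@bounded_rvW _ _ _ c); last by move=> x; exact: clampB.
  by apply: measurable_maxr => //; exact: measurable_minr.
pose K (z : R * R) := clamp A z.1 * clamp B z.2.
have bK : bounded_rv K.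
  apply: bounded_rvM.
    by apply: (bounded_rv_comp (bclamp A A0).1 (clampB A ^~ A0)).
  by apply: (bounded_rv_comp (bclamp B B0).1 (clampB B ^~ B0)).
transitivity (\int[P]_w K (X w, Y w)).
  by apply: eq_Rintegral => w _; rewrite /K/= !clampE.
rewrite (Rexp_indep bX.1 bY.1 iXY bK).
transitivity (\int[P]_w (X w * \int[P]_w' Y w')).
  apply: eq_Rintegral => w _; rewrite -RexpZ//.
  by apply: eq_Rintegral => w' _; rewrite /K/= !clampE.
rewrite -[RHS]mulrC -RexpZ//.
by apply: eq_Rintegral => w _; rewrite mulrC.
Qed.

Section leave_one_out.
Context d (T : measurableType d) (R : realType) (P : probability T R).
Context (m : nat) (X : 'I_m -> T -> R).
Hypothesis mX : forall i, measurable_fun [set: T] (X i).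
Hypothesis indepX : mutually_independent P X.

(** With the event on [X i] fixed, [m1] and [m2] are two finite measures that agree on the
    rectangles in the other coordinates. These form a pi-system, so the measures agree on the
    sigma-algebra it generates, which contains the events of the sum. *)
Lemma independent_leave_one_out (i : 'I_m) (g : 'I_m -> R -> R) :
  (forall j, measurable_fun [set: R] (g j)) ->
  independent_rv P (X i) (fun w => \sum_(j | j != i) g j (X j w)).
Proof.
move=> mg A B mA mB.
have mXp j C : measurable C -> measurable (X j @^-1` C).
  by move=> mC; rewrite -[X in measurable X]setTI; exact: mX.
pose G : set (set T) := [set C | exists D : 'I_m -> set R,
  (forall j, measurable (D j)) /\
  C = \bigcap_(j in [set` [set~ i]%SET]) (X j @^-1` D j)].
have Gm : G `<=` measurable.
  move=> _ [D [mD ->]]; apply: fin_bigcap_measurable => // j _.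
  exact: mXp.
have GT : G setT.
  exists (fun=> setT); split=> //.
  by apply/esym; rewrite -subTset => w _ j _.
have GI : setI_closed G.
  move=> _ _ [D [mD ->]] [E [mE ->]]; exists (fun j => D j `&` E j); split.
    by move=> j; exact: measurableI.
  by rewrite -bigcapI.
have r0 : 0 <= fine (P (X i @^-1` A)) by apply: fine_ge0.
pose m1 : {measure set T -> \bar R} := mrestr P (mXp i A mA).
pose m2 : {measure set T -> \bar R} := mscale (NngNum r0) P.
have m2E C : m2 C = (P (X i @^-1` A) * P C)%E.
  by rewrite /m2/= /mscale/= fineK// fin_num_measure//; exact: (mXp i A mA).
(* Inserting [A] as the side of index [i] gives a full rectangle, to which mutual independence
   applies. *)
have m12 C : G C -> m1 C = m2 C.
  move=> [D [mD ->]]; rewrite m2E /m1/= /mrestr.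
  pose D' j := if j == i then A else D j.
  have -> : \bigcap_(j in [set` [set~ i]%SET]) (X j @^-1` D j) `&` X i @^-1` A
      = \bigcap_(j in [set` [set: 'I_m]%SET]) (X j @^-1` D' j).
    apply/seteqP; split=> w /=.
      move=> [wD wA] j _; rewrite /D'; case: eqVneq => [->//|ji].
      by apply: wD => /=; rewrite !inE.
    move=> h; split; last by have := h i; rewrite /D'/= eqxx inE; exact.
    move=> j /=; rewrite !inE => ji; have := h j; rewrite /D'/= (negbTE ji) inE.
    exact.
  have mD' j : measurable (D' j) by rewrite /D'; case: ifP.
  rewrite (indepX _ mD') (indepX _ mD) (bigD1 i) ?inE//= {1}/D' eqxx.
  congr (_ * _)%E; apply: eq_big => [j|j]; rewrite !inE//= /D' => /negbTE ->//.
have sB : <<s G >> ((fun w => \sum_(j | j != i) g j (X j w)) @^-1` B).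
  have : measurable_fun [set: g_sigma_algebraType G]
      (fun w => \sum_(j | j != i) g j (X j w)).
    rewrite (_ : (fun w => _) =
      (fun w => \sum_(j <- index_enum 'I_m | j != i) g j (X j w)))//.
    (* The induction runs over the filtered list, so that it only meets indices other than [i]: the
       variable [X i] itself need not be measurable for this sigma-algebra. *)
    under eq_fun do rewrite -big_filter.
    have : all (fun j => j != i) [seq j <- index_enum 'I_m | j != i].
      exact: filter_all.
    elim: [seq j <- index_enum 'I_m | j != i] => [_|j s IH /= /andP[ji si]].
      by under eq_fun do rewrite big_nil; exact: measurable_cst.
    under eq_fun do rewrite big_cons.
    apply: measurable_funD; last exact: IH.
    apply: measurableT_comp => // _ C mC; rewrite setTI.
    apply: sub_sigma_algebra.
    exists (fun k => if k == j then C else setT); split.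
      by move=> k; case: ifP.
    apply/seteqP; split=> w /= wC.
      by move=> k _ /=; case: eqVneq => [->|].
    by have := wC j; rewrite /= !inE eqxx; exact.
  by move=> /(_ measurableT _ mB); rewrite setTI.
rewrite -m2E -(@g_sigma_algebra_measure_unique _ _ _ G Gm (fun=> setT) _ _
  m1 m2 GI m12 _ _ sB)//.
- by rewrite /m1/= /mrestr setIC.
- by rewrite bigcup_const.
- by move=> _; rewrite /m1/= /mrestr (le_lt_trans (probability_le1 _ _)) ?ltry//
    setTI; exact: (mXp i A mA).
Qed.

End leave_one_out.

(** * Sums of independent centered variables *)

Section centered_sum.
Context d (T : measurableType d) (R : realType) (P : probability T R).
Context (m : nat) (chi : 'I_m -> T -> R) (g : R -> R) (dl : R).
Hypothesis mchi : forall i, measurable_fun [set: T] (chi i).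
Hypothesis indep_chi : mutually_independent P chi.
Hypothesis mg : measurable_fun [set: R] g.
Hypothesis gdl : forall x, `|g x| <= dl.
Hypothesis g0 : forall i, \int[P]_w g (chi i w) = 0.

Let W w := \sum_i g (chi i w).
Let V i w := \sum_(j | j != i) g (chi j w).

Let WE i w : W w = V i w + g (chi i w).
Proof. by rewrite /W (bigD1 i)//= addrC. Qed.

Let bxi i : bounded_rv (fun w => g (chi i w)).
Proof. exact: bounded_rv_comp. Qed.

Lemma bounded_rv_centered_sum : bounded_rv W.
Proof. exact: bounded_rv_sum. Qed.

Let bV i : bounded_rv (V i).
Proof. exact: bounded_rv_sum. Qed.

Let indep i (a b : R -> R) : measurable_fun [set: R] a ->
  measurable_fun [set: R] b ->
  bounded_rv (fun w => a (g (chi i w))) -> bounded_rv (fun w => b (V i w)) ->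
  \int[P]_w (a (g (chi i w)) * b (V i w)) =
  (\int[P]_w a (g (chi i w))) * (\int[P]_w b (V i w)).
Proof.
move=> ma mb ba bb; apply: Rexp_indepM => //.
apply: (@independent_rv_comp _ _ _ _ (chi i) (V i) (a \o g) b) => //.
  exact: measurableT_comp.
exact: (@independent_leave_one_out _ _ _ P m chi mchi indep_chi i (fun=> g)).
Qed.

Let bxi2 i : bounded_rv (fun w => g (chi i w) ^+ 2).
Proof. exact: bounded_rvX. Qed.

Let bV2 i : bounded_rv (fun w => V i w ^+ 2).
Proof. exact: bounded_rvX. Qed.

Let v i := \int[P]_w (g (chi i w) ^+ 2).

Let v_ge0 i : 0 <= v i.
Proof. by apply: Rintegral_ge0 => w _; exact: sqr_ge0. Qed.

Let orth i : \int[P]_w (g (chi i w) * V i w) = 0.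
Proof.
by rewrite (@indep i id id)// g0 mul0r.
Qed.

(** One factor of the square is expanded as a sum and the other is split as [V i w + g (chi i w)];
    the first part is orthogonal to [g (chi i w)]. *)
Lemma variance_centered_sum :
  \int[P]_w (W w ^+ 2) = \sum_i \int[P]_w (g (chi i w) ^+ 2).
Proof.
transitivity (\int[P]_w (\sum_i (g (chi i w) * V i w + g (chi i w) ^+ 2))).
  apply: eq_Rintegral => w _; rewrite expr2 {1}/W mulr_suml.
  by apply: eq_bigr => i _; rewrite (WE i) mulrDr expr2.
rewrite Rexp_sum; last by move=> i; apply: bounded_rvD => //; exact: bounded_rvM.
apply: eq_bigr => i _; rewrite RexpD//; last exact: bounded_rvM.
by rewrite orth add0r.
Qed.

(** The cross term vanishes, so adding back the missing summand only increases the second moment.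
    This makes the error bounds uniform in [i]. *)
Let V_var i : \int[P]_w (V i w ^+ 2) <= \int[P]_w (W w ^+ 2).
Proof.
rewrite [leRHS](_ : _ = \int[P]_w
    (V i w ^+ 2 + (2 * (g (chi i w) * V i w) + g (chi i w) ^+ 2))).
  rewrite RexpD//; last first.
    apply: bounded_rvD => //; apply: bounded_rvM; first exact: bounded_rv_cst.
    exact: bounded_rvM.
  rewrite RexpD//; last first.
    apply: bounded_rvM; first exact: bounded_rv_cst.
    exact: bounded_rvM.
  rewrite RexpZ; last exact: bounded_rvM.
  by rewrite orth mulr0 add0r lerDl; exact: v_ge0.
by apply: eq_Rintegral => w _; rewrite (WE i); ring.
Qed.

(* [V i] is independent of [g (chi i)], which is centered, so that
   E(W phi(W)) = sum_i E(g(chi_i) (phi(V_i + g(chi_i)) - phi(V_i))). *)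
Lemma stein_bound (phi psi : R -> R) (B eps : R) :
  (forall x : R, is_derive x 1 phi (psi x)) ->
  continuous psi -> (forall x, `|phi x| <= B) -> (forall x, `|psi x| <= B) ->
  0 <= eps ->
  (forall x y, `|y| <= dl -> `|psi (x + y) - psi x| <= eps * (1 + x ^+ 2)) ->
  `|\int[P]_w (W w * phi (W w)) -
      \int[P]_w (W w ^+ 2) * \int[P]_w psi (W w)|
    <= 2 * eps * \int[P]_w (W w ^+ 2) * (1 + \int[P]_w (W w ^+ 2)).
Proof.
move=> dphi cpsi phiB psiB eps0 mod; set vW := \int[P]_w (W w ^+ 2).
have mphi : measurable_fun [set: R] phi.
  apply: continuous_measurable_fun => x; apply: differentiable_continuous.
  by apply/derivable1_diffP; case: (dphi x).
have mpsi : measurable_fun [set: R] psi by exact: continuous_measurable_fun.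
have bW := bounded_rv_centered_sum.
have bphi (Y : T -> R) : bounded_rv Y -> bounded_rv (fun w => phi (Y w)).
  by move=> bY; exact: (bounded_rv_comp mphi phiB bY.1).
have bpsi (Y : T -> R) : bounded_rv Y -> bounded_rv (fun w => psi (Y w)).
  by move=> bY; exact: (bounded_rv_comp mpsi psiB bY.1).
have bmod i : bounded_rv (fun w => eps * (1 + V i w ^+ 2)).
  apply: bounded_rvM; first exact: bounded_rv_cst.
  by apply: bounded_rvD => //; exact: bounded_rv_cst.
have Emod i : \int[P]_w (eps * (1 + V i w ^+ 2)) <= eps * (1 + vW).
  rewrite RexpZ; last by apply: bounded_rvD => //; exact: bounded_rv_cst.
  rewrite RexpD ?Rexp_cst//; last exact: bounded_rv_cst.
  by rewrite ler_wpM2l// lerD2l V_var.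
(* By the mean value theorem, the increment of [phi] is [y * psi (x + z)] with [z] no larger than
   [y]; the weighted modulus then replaces [psi (x + z)] by [psi x]. *)
have taylor i w : `|g (chi i w) * (phi (W w) - phi (V i w)) -
    g (chi i w) ^+ 2 * psi (V i w)| <=
    g (chi i w) ^+ 2 * (eps * (1 + V i w ^+ 2)).
  set x := V i w; set y := g (chi i w).
  have ydl : `|y| <= dl by exact: gdl.
  have [z zy ->] : exists2 z, `|z| <= dl & phi (W w) - phi x = y * psi (x + z).
    rewrite (WE i) -/x -/y.
    have cphi a b : {within `[a, b], continuous phi}.
      apply: continuous_subspaceT => u; apply: differentiable_continuous.
      by apply/derivable1_diffP; case: (dphi u).
    have [y0|y0] := leP 0 y.
      have [||c cI ->] := @MVT_segment _ phi psi x (x + y) => //.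
        by rewrite lerDl.
      exists (c - x).
        rewrite (le_trans _ ydl)// (ger0_norm y0).
        move: cI; rewrite in_itv/= => /andP[xc cx].
        by rewrite ger0_norm ?subr_ge0// lerBlDl.
      have -> : x + (c - x) = c by ring.
      by rewrite mulrC; congr (_ * _); ring.
    have [||c cI h] := @MVT_segment _ phi psi (x + y) x => //.
      by rewrite gerDl ltW.
    exists (c - x).
      rewrite (le_trans _ ydl)// (ltr0_norm y0).
      move: cI; rewrite in_itv/= => /andP[xc cx].
      by rewrite ler0_norm ?subr_le0// lerN2 lerBrDl.
    have -> : x + (c - x) = c by ring.
    by rewrite -opprB h; ring.
  rewrite mulrA -expr2 -mulrBr normrM ger0_norm ?sqr_ge0//.
  by rewrite ler_wpM2l ?sqr_ge0// mod.
have bD i : bounded_rv (fun w => g (chi i w) * (phi (W w) - phi (V i w))).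
  by apply: bounded_rvM => //; apply: bounded_rvB; exact: bphi.
(* The factor 2 counts two errors of the same size: the Taylor remainder, and the replacement of
   [psi (V i w)] by [psi (W w)]. Subtracting [phi (V i w)] in [e1] is free because [g (chi i w)] is
   centered and independent of it. *)
have main i : `|\int[P]_w (g (chi i w) * phi (W w)) -
    v i * \int[P]_w psi (W w)| <= 2 * eps * v i * (1 + vW).
  have e1 : \int[P]_w (g (chi i w) * phi (W w)) =
      \int[P]_w (g (chi i w) * (phi (W w) - phi (V i w))).
    under [RHS]eq_Rintegral do rewrite mulrBr.
    rewrite RexpB; [|by apply: bounded_rvM => //; exact: bphi..].
    by rewrite (@indep i id phi)//; [rewrite g0 mul0r subr0|exact: bphi].
  have e2 : v i * \int[P]_w psi (V i w) =
      \int[P]_w (g (chi i w) ^+ 2 * psi (V i w)).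
    by rewrite (@indep i (fun x => x ^+ 2) psi)//; exact: bpsi.
  have e3 : \int[P]_w (g (chi i w) ^+ 2 * (eps * (1 + V i w ^+ 2))) =
      v i * \int[P]_w (eps * (1 + V i w ^+ 2)).
    rewrite (@indep i (fun x => x ^+ 2) (fun x => eps * (1 + x ^+ 2)))//.
    apply: measurable_funM; first exact: measurable_cst.
    apply: measurable_funD; first exact: measurable_cst.
    exact: measurable_funX.
  rewrite e1.
  set a := (X in `|X - _|).
  have -> : a - v i * \int[P]_w psi (W w) =
    (a - v i * \int[P]_w psi (V i w)) +
    v i * (\int[P]_w psi (V i w) - \int[P]_w psi (W w)) by ring.
  have -> : 2 * eps * v i * (1 + vW) =
    v i * (eps * (1 + vW)) + v i * (eps * (1 + vW)) by ring.
  rewrite (le_trans (ler_normD _ _))// lerD//.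
    rewrite e2 /a -RexpB//; last by apply: bounded_rvM => //; exact: bpsi.
    apply: (@le_trans _ _ (v i * \int[P]_w (eps * (1 + V i w ^+ 2)))).
      rewrite -e3; apply: le_norm_Rexp => //.
        by apply: bounded_rvB => //; apply: bounded_rvM => //; exact: bpsi.
      exact: bounded_rvM.
    by rewrite ler_wpM2l.
  rewrite normrM (ger0_norm (v_ge0 i)) ler_wpM2l//.
  rewrite -RexpB; [|exact: bpsi..].
  apply: le_trans (Emod i); apply: le_norm_Rexp => //.
    by apply: bounded_rvB; exact: bpsi.
  by move=> w; rewrite distrC (WE i) mod.
have -> : \int[P]_w (W w * phi (W w)) =
    \sum_i \int[P]_w (g (chi i w) * phi (W w)).
  rewrite -Rexp_sum; last by move=> i; apply: bounded_rvM => //; exact: bphi.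
  by apply: eq_Rintegral => w _; rewrite mulr_suml.
have vWE : vW = \sum_i v i by exact: variance_centered_sum.
rewrite [X in X * \int[P]_w _]vWE mulr_suml -sumrB.
rewrite (le_trans (ler_norm_sum _ _ _))//.
rewrite [X in _ * X * _]vWE mulr_sumr mulr_suml.
by apply: ler_sum => i _.
Qed.

End centered_sum.

(** * Stein's equation for the normal law *)

Section gaussian.
Context (R : realType) (s : R).
Hypothesis s0 : 0 < s.
Local Notation mu := (@lebesgue_measure R).
Local Notation pdf := (@normal_pdf R 0 s).
Local Notation N := (@normal_prob R 0 s : probability _ R).

Let sN0 : s != 0. Proof. exact: lt0r_neq0. Qed.

Lemma integrable_bounded_normal_pdf (f : R -> R) (A : set R) :
  measurable A -> bounded_rv f ->
  mu.-integrable A (fun x => (f x * pdf x)%:E).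
Proof.
move=> mA [mf [B fB]].
apply: (integrableS measurableT) => //.
apply: (le_integrable measurableT _ _ (integrableZl measurableT `|B|
  (integrable_normal_pdf 0 s))).
  apply/measurable_EFinP; apply: measurable_funM => //.
  exact: measurable_normal_pdf.
move=> x _ /=; rewrite lee_fin !normrM normr_id ler_wpM2r//.
by rewrite (le_trans (fB x))// ler_norm.
Qed.

(** The Radon-Nikodym derivative of the normal law agrees almost everywhere with [pdf], since both
    have the same integral over every measurable subset. *)
Lemma Rintegral_normal_prob (f : R -> R) (A : set R) :
  measurable A -> bounded_rv f ->
  \int[N]_(x in A) f x = \int[mu]_(x in A) (f x * pdf x).
Proof.
move=> mA bf; congr fine; under [RHS]eq_integral do rewrite EFinM.
have dom := normal_prob_dominates 0 s.
have mpdf : measurable_fun A (EFin \o pdf).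
  apply: measurable_funTS; apply/measurable_EFinP.
  exact: measurable_normal_pdf.
have mf : measurable_fun A (EFin \o f).
  by apply: measurable_funTS; apply/measurable_EFinP; exact: bf.1.
rewrite -(Radon_Nikodym_change_of_variables dom)//=; last first.
  apply: (integrableS measurableT) => //.
  exact: (bounded_rv_integrable N bf).
have mRN : measurable_fun A
    (Radon_Nikodym (charge_of_finite_measure N) mu).
  apply: (measurable_int mu).
  apply: (integrableS _ _ (@subsetT _ _)) => //=.
  exact: Radon_Nikodym_integrable.
apply: ae_eq_integral => //.
- exact: emeasurable_funM.
- exact: emeasurable_funM.
- apply: ae_eqe_mul2l; apply: integral_ae_eq => //.
    apply: (integrableS _ _ (@subsetT _ _)) => //=.
    exact: Radon_Nikodym_integrable.
  by move=> E EA mE; rewrite -Radon_Nikodym_integral.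
Qed.

Lemma continuous_pdf : continuous pdf.
Proof. exact: continuous_normal_pdf. Qed.

Lemma pdf_gt0 x : 0 < pdf x.
Proof. by rewrite normal_pdfE// mulr_gt0 ?normal_peak_gt0// expR_gt0. Qed.

Lemma is_derive_normal_pdf (x : R) :
  is_derive x 1 pdf (- (x / s ^+ 2) * pdf x).
Proof.
pose k := - (s ^+ 2 *+ 2)^-1.
have pdfE : pdf = fun x => normal_peak s * expR (k * x ^+ 2).
  apply/funext => y; rewrite normal_pdfE// /normal_fun /k subr0.
  by rewrite !mulNr [y ^+ 2 / _]mulrC.
have dk : is_derive x 1 (fun x : R => k * x ^+ 2) (k * (x *+ 2)).
  by apply: is_derive_eq; rewrite /GRing.scale/=; ring.
have de : is_derive x 1 (fun x : R => expR (k * x ^+ 2))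
    (expR (k * x ^+ 2) * (k * (x *+ 2))).
  exact: (is_derive1_comp (f := expR)).
rewrite pdfE; apply: is_derive_eq; rewrite /GRing.scale/= /k; field.
by rewrite sN0.
Qed.

(* [Th y - C * s ^+ 2 * pdf y / y] is nondecreasing and tends to 0. *)
Lemma mills_bound (Th th : R -> R) (C : R) : 0 <= C ->
  (forall x : R, is_derive x 1 Th (th x * pdf x)) -> (forall x, `|th x| <= C) ->
  Th x @[x --> +oo] --> 0 ->
  forall x, 0 < x -> x * `|Th x| <= C * s ^+ 2 * pdf x.
Proof.
move=> C0.
have main (T t : R -> R) : (forall x : R, is_derive x 1 T (t x * pdf x)) ->
    (forall x, `|t x| <= C) -> T x @[x --> +oo] --> 0 ->
    forall x, 0 < x -> T x <= C * s ^+ 2 * pdf x / x.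
  move=> dT tC T0 x x0.
  pose F (y : R) := T y - C * s ^+ 2 * (pdf y * y^-1).
  have dF (y : R) : 0 < y ->
      is_derive y 1 F (t y * pdf y + C * pdf y + C * s ^+ 2 * pdf y / y ^+ 2).
    move=> y0; have yN0 : y != 0 by exact: lt0r_neq0.
    have di : is_derive y 1 (fun z : R => z^-1) (- y ^- 2).
      apply: (is_derive_eq (is_deriveV (f := id) yN0 (is_derive_id _ _))).
      by rewrite /GRing.scale/= mulr1.
    have dp := is_derive_normal_pdf y.
    apply: is_derive_eq; rewrite /GRing.scale/=; field.
    by rewrite yN0 sN0.
  have mono : forall y, x <= y -> F x <= F y.
    move=> y xy; apply: (@ger0_derive1_ndecry _ F x _ _ _ x y (lexx x) xy).
    - move=> z; rewrite in_itv/= andbT => xz.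
      by have [] := dF z (lt_trans x0 xz).
    - move=> z; rewrite in_itv/= andbT => xz.
      have z0 := lt_trans x0 xz.
      have dFz := dF z z0.
      rewrite derive1E derive_val -mulrDl addr_ge0//.
        rewrite mulr_ge0 ?normal_pdf_ge0//.
        by have := tC z; rewrite ler_norml => /andP[h _]; lra.
      by rewrite divr_ge0 ?sqr_ge0// mulr_ge0 ?normal_pdf_ge0// mulr_ge0 ?sqr_ge0.
    - apply: derivable_within_continuous => z; rewrite in_itv/= andbT => xz.
      by have [] := dF z (lt_le_trans x0 xz).
  rewrite -subr_le0 -mulrA -/(F x).
  apply: (cvgr_to_ge T0); near=> y.
  apply: (le_trans (mono y _)); first by near: y; apply: nbhs_pinfty_ge; exact: num_real.
  have y0 : 0 <= y by near: y; apply: nbhs_pinfty_ge; exact: num_real.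
  rewrite /F gerBl; apply: mulr_ge0; first by rewrite mulr_ge0 ?sqr_ge0.
  by rewrite divr_ge0 ?normal_pdf_ge0.
move=> dTh thC Th0 x x0.
rewrite mulrC -ler_pdivlMr// ler_norml lerNl; apply/andP; split.
  apply: (main (fun x => - Th x) (fun x => - th x)) => //.
  - by move=> y; apply: is_derive_eq; rewrite mulNr.
  - by move=> y; rewrite normrN.
  - by rewrite -oppr0; exact: cvgN.
exact: (main Th th).
Unshelve. all: by end_near. Qed.


Let X : measurableTypeR R -> R := idfun.
Let mX : measurable_fun [set: measurableTypeR R] X.
Proof. exact: measurable_id. Qed.
HB.instance Definition _ := @isMeasurableFun.Build _ _ _ _ X mX.

Lemma normal_prob_right_tail (e : R) : 0 < e ->
  \forall x \near +oo%R, fine (N `](x : R), +oo[%classic) <= e.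
Proof.
move=> e0.
have : fine \o ccdf (X : {RV N >-> R}) @ +oo%R --> (0 : R).
  exact: (fine_cvg (cvg_ccdfy0 _)).
move=> /cvgr0Pnorm_le/(_ e e0); apply: filterS => x; apply: le_trans.
by rewrite (le_trans _ (ler_norm _)).
Qed.

Lemma normal_prob_left_tail (e : R) : 0 < e ->
  \forall x \near +oo%R, fine (N `]-oo, - (x : R)]%classic) <= e.
Proof.
move=> e0.
have : fine \o cdf (X : {RV N >-> R}) @ -oo%R --> (0 : R).
  exact: (fine_cvg (cvg_cdfNy0 _)).
rewrite cvgNy_compNP => /cvgr0Pnorm_le/(_ e e0); apply: filterS => x; apply: le_trans.
by rewrite (le_trans _ (ler_norm _)).
Qed.

(** Stein's equation is linear of first order: [pdf] is an integrating factor, as the derivative of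
    [s ^+ 2 * pdf * phi] equals [pdf] times the left-hand side. So [phi] is the primitive [Psi] of
    [g * pdf] divided by [s ^+ 2 * pdf]. Boundedness is the real content: the Gaussian decay of
    [pdf] has to be matched by that of [Psi]. *)
Lemma stein_solution (h : R -> R) (B : R) :
  continuous h -> (forall x, `|h x| <= B) ->
  exists phi psi : R -> R, exists B' : R,
  [/\ forall x : R, is_derive x 1 phi (psi x), continuous psi,
      forall x, `|phi x| <= B', forall x, `|psi x| <= B' &
      forall x, s ^+ 2 * psi x - x * phi x = h x - \int[N]_y h y].
Proof.
move=> ch hB.
set m := \int[N]_y h y.
have mh : measurable_fun [set: R] h by exact: continuous_measurable_fun.
have bh : @bounded_rv _ (measurableTypeR R) R h by exact: (bounded_rvW mh hB).
have B0 : 0 <= B by rewrite (le_trans _ (hB 0)).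
have mB : `|m| <= B by exact: (le_norm_Rexp_cst N bh).
pose g x := h x - m.
have gC x : `|g x| <= 2 * B.
  by rewrite (le_trans (ler_normB _ _))// mulr2n mulrDl mul1r lerD.
have C0 : 0 <= 2 * B by rewrite mulr_ge0.
have bg : @bounded_rv _ (measurableTypeR R) R g.
  by apply: (bounded_rvB bh); exact: bounded_rv_cst.
have cg : continuous g by move=> x; apply: cvgB; [exact: ch|exact: cvg_cst].
have g0 : \int[N]_y g y = 0.
  by rewrite RexpB ?Rexp_cst ?subrr//; exact: bounded_rv_cst.
pose Psi x := \int[mu]_(t in `]-oo, x]) (g t * pdf t).
have dPsi (x : R) : is_derive x 1 Psi (g x * pdf x).
  have xx1 : x < x + 1 by rewrite ltrDl.
  have [|||d1 d2] := @continuous_FTC1 R (fun t => g t * pdf t) -oo%O x _ xx1.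
  - exact: integrable_bounded_normal_pdf.
  - by rewrite ltNyr.
  - by apply: cvgM; [exact: cg|exact: continuous_pdf].
  by rewrite /Psi; apply: DeriveDef; [exact: d1|rewrite -derive1E; exact: d2].
have tail (A : set R) : measurable A ->
    `|\int[mu]_(t in A) (g t * pdf t)| <= 2 * B * fine (N A).
  move=> mA; rewrite -Rintegral_normal_prob//.
  have iN (f : R -> R) : @bounded_rv _ (measurableTypeR R) R f ->
      N.-integrable A (EFin \o f).
    by move=> bf; apply: (integrableS measurableT) => //; exact: bounded_rv_integrable.
  rewrite (le_trans (le_normr_Rintegral _ _))//; first exact: iN.
  rewrite -Rintegral_cst//; apply: le_Rintegral => //.
    by apply: iN; exact: bounded_rv_norm.
  by apply: iN; exact: bounded_rv_cst.
have C1 : 0 < 2 * B + 1 by rewrite ltr_wpDl.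
have Cle e (t : R) : 0 < e -> 0 <= t -> t <= e / (2 * B + 1) ->
    2 * B * t <= e.
  move=> e0 t0; rewrite ler_pdivlMr// => te.
  by rewrite (le_trans _ te)// [leRHS]mulrC ler_wpM2r// lerDl.
have Psiy : Psi x @[x --> +oo] --> 0.
  apply/cvgr0Pnorm_le => e e0.
  have := normal_prob_right_tail (divr_gt0 e0 C1).
  apply: filterS => x /(Cle _ _ e0 (fine_ge0 (measure_ge0 _ _))).
  apply: le_trans.
  (* [g] has mean 0 under the normal law, so the integral up to [x] is the opposite of the integral
     beyond [x]. *)
  rewrite (_ : Psi x = - \int[mu]_(t in `]x, +oo[) (g t * pdf t)).
    by rewrite normrN; exact: tail.
  rewrite -(@Rintegral_itvB _ _ -oo%O +oo%O x)//; last first.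
    exact: integrable_bounded_normal_pdf.
  by rewrite set_itvE -Rintegral_normal_prob// g0 sub0r opprK.
have PsiNy : Psi (- x) @[x --> +oo] --> 0.
  apply/cvgr0Pnorm_le => e e0.
  have := normal_prob_left_tail (divr_gt0 e0 C1).
  apply: filterS => x /(Cle _ _ e0 (fine_ge0 (measure_ge0 _ _))).
  by apply: le_trans; exact: tail.
(* On the negative side the same bound is applied to the reflected function, [pdf] being even. *)
have xPsi x : `|x| * `|Psi x| <= 2 * B * s ^+ 2 * pdf x.
  have [x0|x0|->] := ltrgt0P x.
  - exact: (mills_bound C0 dPsi gC Psiy).
  - have pdfN : pdf (- x) = pdf x.
      by rewrite normal_pdfE// /normal_fun !subr0 sqrrN.
    rewrite -pdfN -{2}(opprK x).
    apply: (@mills_bound (fun y => Psi (- y)) (fun y => - g (- y))) => //.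
    + move=> y.
      have dN : is_derive y 1 (fun z : R => - z) (- 1) by exact: is_deriveN.
      have := is_derive1_comp (f := Psi) (g := fun z => - z) (dPsi (- y)) dN.
      rewrite /comp => dc; apply: (is_derive_eq dc).
      have -> : pdf y = pdf (- y).
        by rewrite normal_pdfE// /normal_fun !subr0 sqrrN.
      ring.
    + by move=> y; rewrite normrN.
    + by rewrite oppr_gt0.
  - by rewrite ?normr0 mul0r mulr_ge0 ?normal_pdf_ge0// mulr_ge0 ?sqr_ge0.
pose phi x := Psi x / (s ^+ 2 * pdf x).
pose psi x := (g x + x * phi x) / s ^+ 2.
have pdfN0 x : pdf x != 0 by exact/lt0r_neq0/pdf_gt0.
have s2 : 0 < s ^+ 2 by rewrite exprn_gt0.
have dphi (x : R) : is_derive x 1 phi (psi x).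
  have dp := is_derive_normal_pdf x.
  have di : is_derive x 1 (fun y => (pdf y)^-1)
      (- (pdf x) ^- 2 *: (- (x / s ^+ 2) * pdf x)).
    exact: is_deriveV.
  have -> : phi = fun y => (s ^+ 2)^-1 * (Psi y * (pdf y)^-1).
    by apply/funext => y; rewrite /phi invfM mulrCA.
  have dM := is_deriveM (dPsi x) di.
  apply: (is_derive_eq (is_deriveZ (s ^+ 2)^-1 dM)).
  rewrite /GRing.scale/= /psi /phi; field.
  by rewrite pdfN0 sN0.
have cphi : continuous phi.
  move=> x; apply: differentiable_continuous.
  by apply/derivable1_diffP; case: (dphi x).
have xphi x : `|x * phi x| <= 2 * B.
  rewrite normrM /phi normrM normfV mulrA ler_pdivrMr; last first.
    by rewrite normr_gt0 mulf_neq0// gt_eqF.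
  by rewrite (ger0_norm (mulr_ge0 (ltW s2) (ltW (pdf_gt0 x)))) mulrA xPsi.
(* [A] bounds [phi] on [-1, 1], where [pdf] is at least [pdf 1] and [Psi] is at most [2 * B];
   outside, the bound on [x * phi x] suffices. *)
pose A := 2 * B / (s ^+ 2 * pdf 1).
have A0 : 0 <= A by rewrite divr_ge0// mulr_ge0 ?ltW ?pdf_gt0.
have phiB x : `|phi x| <= A + 2 * B.
  have [x1|x1] := leP 1 `|x|.
    rewrite (@le_trans _ _ (2 * B)) ?lerDr//.
    by apply: le_trans (xphi x); rewrite [leRHS]normrM ler_peMl.
  rewrite (@le_trans _ _ A) ?lerDl//.
  rewrite /phi normrM normfV /A ler_pM ?invr_ge0//.
    apply: (le_trans (tail _ _)) => //.
    rewrite -[leRHS]mulr1 ler_wpM2l// -lee_fin fineK ?fin_num_measure//.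
    exact: probability_le1.
  rewrite (ger0_norm (mulr_ge0 (ltW s2) (ltW (pdf_gt0 x)))).
  rewrite lef_pV2 ?posrE ?mulr_gt0 ?pdf_gt0//.
  apply: ler_wpM2l; first exact: ltW.
  have pdfE y : pdf y = normal_peak s * normal_fun 0 s y.
    by rewrite normal_pdfE.
  rewrite !pdfE; apply: ler_wpM2l; first exact: normal_peak_ge0.
  rewrite ler_expR !subr0.
  rewrite ler_wpM2r ?invr_ge0 ?mulrn_wge0 ?sqr_ge0// lerN2.
  by rewrite -(real_normK (num_real x)) lerXn2r ?nnegrE// ltW.
have psiB x : `|psi x| <= 4 * B / s ^+ 2.
  rewrite normrM normfV (ger0_norm (ltW s2)) ler_pM2r ?invr_gt0//.
  rewrite (le_trans (ler_normD _ _))//.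
  have -> : 4 * B = 2 * B + 2 * B by ring.
  exact: lerD.
exists phi, psi, (A + 2 * B + 4 * B / s ^+ 2); split => //.
- move=> x; apply: cvgM; last exact: cvg_cst.
  apply: cvgD; first exact: cg.
  by apply: cvgM; [exact: cvg_id|exact: cphi].
- by move=> x; rewrite (le_trans (phiB x))// lerDl divr_ge0 ?sqr_ge0// mulr_ge0.
- by move=> x; rewrite (le_trans (psiB x))// lerDr addr_ge0.
- by move=> x; rewrite /psi mulrC divfK ?gt_eqF// addrK.
Qed.

End gaussian.

(** * The central limit theorem for small summands *)

(* The weight [1 + x ^+ 2] makes the modulus global in [x], so that only second
   moments are needed to integrate it. *)
Lemma bounded_continuous_modulus (R : realType) (k : R -> R) (B e : R) :
  continuous k -> (forall x, `|k x| <= B) -> 0 < e ->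
  exists dl : R, 0 < dl /\
    forall x y, `|y| <= dl -> `|k (x + y) - k x| <= e * (1 + x ^+ 2).
Proof.
move=> ck kB e0.
have B0 : 0 <= B by rewrite (le_trans _ (kB 0)).
(* Beyond [K] the weight alone wins: [x ^+ 2] is at least [K] and [e * K] exceeds the trivial bound
   [2 * B]. Compactness is only used on [-K, K]. *)
pose K := 2 * B / e + 1.
have K1 : 1 <= K by rewrite lerDr divr_ge0 ?mulr_ge0 ?(ltW e0).
have /compact_near_coveringP/(_ R 0^'+
  (fun dl x => forall y, `|y| <= dl -> `|k (x + y) - k x| <= e)) :=
  @segment_compact R (- K) K.
case.
  move=> x _.
  have /cvgrPdist_lt/(_ (e / 2)) := ck x.
  rewrite divr_gt0// => /(_ isT)/nbhs_ballP[eta /= eta0 ballk].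
  exists (ball x (eta / 2), [set dl | 0 < dl < eta / 2]) => /=.
    split; first by apply: nbhsx_ballx; rewrite divr_gt0.
    near=> dl => /=; apply/andP; split=> //.
    by near: dl; apply: nbhs_right_lt; rewrite divr_gt0.
  move=> [x' dl] /= [xx' /andP[dl0 dleta]] y ydl.
  rewrite /ball/= in xx'.
  have h1 : `|k x - k (x' + y)| < e / 2.
    apply: ballk; rewrite /ball/= opprD addrA.
    by rewrite (le_lt_trans (ler_normB _ _))//; lra.
  have h2 : `|k x - k x'| < e / 2.
    by apply: ballk; rewrite /ball/=; lra.
  have -> : k (x' + y) - k x' = (k x - k x') - (k x - k (x' + y)) by ring.
  by rewrite (le_trans (ler_normB _ _))//; lra.
move=> r /= r0 rP.
exists (r / 2); split; first by rewrite divr_gt0.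
move=> x y yr.
have [xK|xK] := leP `|x| K.
  apply: (@le_trans _ _ e).
    apply: (rP (r / 2)) => //=.
    - by rewrite sub0r normrN gtr0_norm ?divr_gt0//; lra.
    - by rewrite divr_gt0.
    - by rewrite in_itv/= -ler_norml.
  by rewrite mulrDr mulr1 lerDl mulr_ge0 ?sqr_ge0 ?ltW.
rewrite (le_trans (ler_normB _ _))// (le_trans (lerD (kB _) (kB _)))//.
have x2 : K <= x ^+ 2.
  rewrite -(real_normK (num_real x)) (le_trans (ltW xK))// expr2.
  by rewrite ler_peMl// (le_trans K1)// ltW.
apply: (@le_trans _ _ (e * K)).
  have -> : e * K = B + B + e by rewrite /K; field; rewrite gt_eqF.
  by rewrite lerDl ltW.
by rewrite (ler_pM2l e0) (le_trans x2)// lerDr.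
Unshelve. all: by end_near. Qed.

Section clt.
Context (R : realType) (p : nat -> nat) (d : nat -> measure_display)
  (T : forall n, measurableType (d n)) (P : forall n, probability (T n) R)
  (chi : forall n, 'I_(p n) -> T n -> R) (g : nat -> R -> R) (dl : nat -> R).
Hypothesis mchi : forall n i, measurable_fun [set: T n] (@chi n i).
Hypothesis indep_chi : forall n, mutually_independent (P n) (@chi n).
Hypothesis mg : forall n, measurable_fun [set: R] (g n).
Hypothesis gdl : forall n x, `|g n x| <= dl n.
Hypothesis dl0 : dl @ \oo --> 0.
Hypothesis g0 : forall n i, \int[P n]_w g n (@chi n i w) = 0.

Let W n w := \sum_i g n (@chi n i w).
Let V n := \int[P n]_w (W w ^+ 2).

Let bW n : bounded_rv (@W n).
Proof. exact: (bounded_rv_centered_sum (@mchi n) (mg n) (gdl n)). Qed.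

Let V_ge0 n : 0 <= V n.
Proof. by apply: Rintegral_ge0 => w _; exact: sqr_ge0. Qed.

(** Stein's equation is solved once for the limit law, so [phi] and [psi] do not depend on [n]; the
    discrepancy of the variances is the separate term [(v - V n)] times the mean of [psi (W w)]. For
    [v = 0] the sum tends to 0 in mean square, and a Chebyshev-type bound on [h (W w) - h 0] is
    enough. *)
Theorem clt (v : R) (h : R -> R) (B : R) :
  V n @[n --> \oo] --> v -> continuous h -> (forall x, `|h x| <= B) ->
  \int[P n]_w h (W w) @[n --> \oo] --> \int[centered_normal v]_x h x.
Proof.
move=> Vv ch hB.
have B0 : 0 <= B by rewrite (le_trans _ (hB 0)).
have mh : measurable_fun [set: R] h by exact: continuous_measurable_fun.
have bhW n : bounded_rv (fun w : T n => h (W w)).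
  exact: (bounded_rv_comp mh hB (bW n).1).
have v0 : 0 <= v by apply: (cvgr_to_ge Vv); exact: nearW.
rewrite /centered_normal; case: eqVneq => [v00|vN0].
  rewrite /Rintegral integral_dirac//; last exact/measurable_EFinP.
  rewrite diracT mul1e /=.
  apply/cvgrPdistC_le => e e0.
  have [dlh [dlh0 modh]] := bounded_continuous_modulus ch hB (divr_gt0 e0 (ltr0n R 2)).
  have bd n : `|\int[P n]_w h (W w) - h 0| <= e / 2 + 2 * B / dlh ^+ 2 * V n.
    rewrite -(Rexp_cst (P n) (h 0)) -RexpB//; last exact: bounded_rv_cst.
    have bW2 := bounded_rvX 2 (bW n).
    rewrite -(Rexp_cst (P n) (e / 2)) /V -RexpZ// -RexpD//; last 2 first.
    - exact: bounded_rv_cst.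
    - by apply: bounded_rvM => //; exact: bounded_rv_cst.
    apply: le_norm_Rexp.
    - by apply: bounded_rvB => //; exact: bounded_rv_cst.
    - apply: bounded_rvD; first exact: bounded_rv_cst.
      by apply: bounded_rvM => //; exact: bounded_rv_cst.
    move=> w; have [Wle|Wgt] := leP `|W w| dlh.
      have := modh 0 _ Wle; rewrite add0r expr0n/= addr0 mulr1 => /le_trans.
      by apply; rewrite lerDl mulr_ge0 ?sqr_ge0// divr_ge0 ?sqr_ge0 ?mulr_ge0.
    rewrite (le_trans (ler_normB _ _))// (le_trans (lerD (hB _) (hB _)))//.
    apply: (@le_trans _ _ (2 * B / dlh ^+ 2 * W w ^+ 2)).
      rewrite mulrAC -mulrA -mulr2n -[leLHS]mulr_natl ler_peMr ?mulr_ge0//.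
      rewrite ler_pdivlMr ?exprn_gt0// mul1r -(real_normK (num_real (W w))).
      by rewrite lerXn2r ?nnegrE// ltW.
    by rewrite lerDr divr_ge0 ?ltW.
  have : 2 * B / dlh ^+ 2 * V n @[n --> \oo] --> 2 * B / dlh ^+ 2 * v.
    by apply: cvgM; [exact: cvg_cst|exact: Vv].
  rewrite v00 mulr0 => /cvgr0Pnorm_le/(_ _ (divr_gt0 e0 (ltr0n R 2))).
  apply: filterS => n hn; rewrite (le_trans (bd n))//.
  by rewrite [leRHS](splitr e) lerD2l (le_trans (ler_norm _)).
have vgt0 : 0 < v by rewrite lt_def vN0.
have s0 : 0 < Num.sqrt v by rewrite sqrtr_gt0.
have [phi [psi [B' [dphi cpsi phiB psiB eq_stein]]]] := stein_solution s0 ch hB.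
rewrite sqr_sqrtr// in eq_stein.
set m := (X in _ --> X).
have B'0 : 0 <= B' by rewrite (le_trans _ (phiB 0)).
apply/cvgrPdistC_le => e e0.
(* As [V n] is eventually at most [v + 1], the Stein error is at most [2 * eps * (v + 1) * (v + 2)],
   which is [e / 2]. *)
pose eps := e / (4 * (v + 1) * (v + 2)).
have den : 0 < 4 * (v + 1) * (v + 2) by rewrite !mulr_gt0// addr_gt0.
have eps0 : 0 < eps by rewrite divr_gt0.
have [dlp [dlp0 modp]] := bounded_continuous_modulus cpsi psiB eps0.
have mphi : measurable_fun [set: R] phi.
  apply: continuous_measurable_fun => x; apply: differentiable_continuous.
  by apply/derivable1_diffP; case: (dphi x).
have mpsi : measurable_fun [set: R] psi by exact: continuous_measurable_fun.
near=> n.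
have bphi : bounded_rv (fun w : T n => phi (W w)).
  exact: (bounded_rv_comp mphi phiB (bW n).1).
have bpsi : bounded_rv (fun w : T n => psi (W w)).
  exact: (bounded_rv_comp mpsi psiB (bW n).1).
have bWphi : bounded_rv (fun w : T n => W w * phi (W w)) by exact: bounded_rvM.
have main : \int[P n]_w h (W w) - m =
    (v - V n) * \int[P n]_w psi (W w) -
    (\int[P n]_w (W w * phi (W w)) - V n * \int[P n]_w psi (W w)).
  transitivity (\int[P n]_w (v * psi (W w) - W w * phi (W w))).
    rewrite -[X in _ - X](Rexp_cst (P n)) -RexpB//; last exact: bounded_rv_cst.
    by apply: eq_Rintegral => w _; rewrite eq_stein.
  rewrite RexpB//; last by apply: bounded_rvM => //; exact: bounded_rv_cst.
  by rewrite RexpZ//; ring.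
have Vn1 : V n <= v + 1.
  by near: n; apply: (cvgr_le _ Vv); rewrite ltrDl.
have dln : dl n <= dlp.
  by near: n; apply: (cvgr_le _ dl0).
have vn : `|v - V n| <= e / (2 * (B' + 1)).
  near: n; move/cvgrPdist_le : Vv; apply.
  by rewrite divr_gt0// mulr_gt0// ltr_wpDl.
have st : `|\int[P n]_w (W w * phi (W w)) - V n * \int[P n]_w psi (W w)|
    <= 2 * eps * V n * (1 + V n).
  exact: (stein_bound (@mchi n) (@indep_chi n) (mg n) (gdl n) (@g0 n) dphi cpsi
    phiB psiB (ltW eps0) (fun x y ydl => modp x y (le_trans ydl dln))).
rewrite main (le_trans (ler_normB _ _))// [leRHS](splitr e) lerD//.
  rewrite normrM.
  apply: (@le_trans _ _ (e / (2 * (B' + 1)) * B')).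
    by rewrite ler_pM//; exact: le_norm_Rexp_cst.
  rewrite invfM mulrA -mulrA ler_piMr ?divr_ge0 ?ltW//.
  by rewrite mulrC ltr_pdivrMr ?mul1r ?ltrDl// ltr_wpDl.
rewrite (le_trans st)//.
apply: (@le_trans _ _ (2 * eps * (v + 1) * (v + 2))).
  have e2 : 0 <= 2 * eps by rewrite mulr_ge0// ltW.
  apply: ler_pM; [by rewrite mulr_ge0|by rewrite addr_ge0| |by lra].
  exact: ler_wpM2l.
rewrite le_eqVlt; apply/orP; left; apply/eqP; rewrite /eps; field.
by rewrite !gt_eqF// addr_gt0.
Unshelve. all: by end_near. Qed.

End clt.

(** * Zeros closest to a point *)

(** Closedness relative to the open half-line: positive zeros may accumulate at 0, where nothing is
    known of the function. *)
Definition closed_in_pos (R : realType) (Z : set R) :=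
  forall u, 0 < u -> closure Z u -> Z u.

Lemma closed_in_posI (R : realType) (Z C : set R) :
  closed_in_pos Z -> closed C -> closed_in_pos (Z `&` C).
Proof.
move=> cZ cC u u0 /closureI[Zu Cu]; split; first exact: cZ.
exact: cC.
Qed.

Lemma closed_in_pos_zeros (R : realType) (U : R -> R) :
  (forall u, 0 < u -> {for u, continuous U}) ->
  closed_in_pos [set u | 0 < u /\ U u = 0].
Proof.
move=> cU u u0 clu; split=> //.
apply: contrapT => /eqP Uu0.
have /cvgrPdist_lt/(_ `|U u|) := cU u u0.
rewrite normr_gt0 => /(_ Uu0) near_u.
by have [z [[_ Uz] /=]] := clu _ near_u; rewrite Uz subr0 ltxx.
Qed.

(** The danger is a minimizing sequence that escapes to 0. A point of [Z] at distance less than [s]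
    from [s] confines the search to a compact segment of positive numbers; without one, all of [Z]
    lies at or beyond [2 * s], where the distance to [s] increases and the least point is sought. *)
Lemma closest_point (R : realType) (Z : set R) (s : R) :
  0 < s -> (forall u, Z u -> 0 < u) -> closed_in_pos Z -> Z !=set0 ->
  exists2 u, Z u & forall v, Z v -> `|u - s| <= `|v - s|.
Proof.
move=> s0 Zpos cZ [z0 Zz0].
have seg a b : 0 < a -> (exists z, Z z /\ a <= z <= b) ->
    exists2 u, Z u /\ a <= u <= b &
      forall v, Z v -> a <= v <= b -> `|u - s| <= `|v - s|.
  move=> a0 [z [Zz zab]].
  have cK : compact (Z `&` `[a, b]).
    apply: (subclosed_compact _ (@segment_compact _ a b)); last by move=> x [].
    move=> x /closureI[Zx].
    move=> /itv_closed.
    rewrite /= in_itv/= => /andP[ax xb]; split; last exact/andP.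
    by apply: cZ => //; exact: (lt_le_trans a0).
  have K0 : Z `&` `[a, b] !=set0.
    by exists z; split=> //; rewrite /= in_itv.
  have cf : {within Z `&` `[a, b], continuous (fun x => `|x - s|)}.
    apply: continuous_subspaceT => x; apply: cvg_norm.
    by apply: cvgB; [exact: cvg_id|exact: cvg_cst].
  have [c /set_mem[Zc cab] cmin] := compact_EVT_min K0 cK cf.
  exists c; first by split.
  move=> v Zv vab; apply: cmin; exact/mem_set.
have [[z [Zz zs]]|nearN] := pselect (exists z, Z z /\ `|z - s| < s).
  have [||u [Zu uI] umin] := seg (s - `|z - s|) (s + `|z - s|).
  - by rewrite subr_gt0.
  - by exists z; split=> //; rewrite -ler_distl.
  exists u => // v Zv.
  have [vI|] := boolP (s - `|z - s| <= v <= s + `|z - s|); first exact: umin.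
  rewrite -ler_distl -ltNge => /ltW; apply: le_trans.
  by rewrite ler_distl.
have far z : Z z -> 2 * s <= z.
  move=> Zz; rewrite leNgt; apply/negP => zs; apply: nearN; exists z; split=> //.
  by rewrite ltr_norml; have := Zpos z Zz; lra.
have [||u [Zu uI] umin] := seg (2 * s) z0.
- by rewrite mulr_gt0.
- by exists z0; rewrite far//= lexx.
exists u => // v Zv; have [vz|zv] := leP v z0; first by rewrite umin// far.
have := far u Zu; have := far v Zv; case/andP: uI => _ uz0.
by move=> h1 h2; rewrite !ger0_norm; lra.
Qed.

Lemma closest_zero_exists (R : realType) (U : R -> R) (s z : R) : 0 < s ->
  (forall u, 0 < u -> {for u, continuous U}) ->
  0 < z -> U z = 0 -> exists u, closest_zero U s u.
Proof.
move=> s0 cU z0 Uz.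
have [||u [u0 Uu] umin] := closest_point s0 _ (closed_in_pos_zeros cU).
- by move=> u [].
- by exists z.
(* At most two points lie at the minimal distance from [s]. The left one is the answer whenever it
   is a positive zero; otherwise [u] is the right one and has no competitor. *)
have [[v0 Uv]|noZ] := pselect (0 < s - `|u - s| /\ U (s - `|u - s|) = 0).
  exists (s - `|u - s|); split=> // v v0' Uv'.
  have := umin v (conj v0' Uv'); rewrite le_eqVlt => /orP[/eqP e|lt].
    right; rewrite -e; split; first by rewrite addrAC subrr add0r normrN normr_id.
    by have := ler_norm (s - v); rewrite e distrC; lra.
  by left; rewrite addrAC subrr add0r normrN normr_id.
exists u; split=> // v v0 Uv.
have := umin v (conj v0 Uv); rewrite le_eqVlt => /orP[/eqP e|lt]; last by left.
right; split=> //; have [su|us] := leP s u; last first.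
  exfalso; apply: noZ.
  have -> : s - `|u - s| = u by rewrite ltr0_norm ?subr_lt0//; ring.
  by [].
move: e; rewrite (ger0_norm (_ : 0 <= u - s)) ?subr_ge0//.
have [sv|vs] := leP s v.
  by rewrite ger0_norm ?subr_ge0// => e; rewrite le_eqVlt; apply/orP; left; lra.
rewrite ltr0_norm ?subr_lt0// => e; exfalso; apply: noZ.
rewrite ger0_norm ?subr_ge0//.
by have -> : s - (u - s) = v by lra.
Qed.

Lemma closest_zero_xget (R : realType) (U : R -> R) (s z : R) : 0 < s ->
  (forall u, 0 < u -> {for u, continuous U}) ->
  0 < z -> U z = 0 ->
  closest_zero U s (xget 1 (closest_zero U s)).
Proof.
move=> s0 cU z0 Uz; have [u cu] := closest_zero_exists s0 cU z0 Uz.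
exact: (xgetI _ cu).
Qed.

Section closest_zero_local.
Context (R : realType) (H : nat -> R -> R) (s sg : nat -> R) (sigma D : R).
Hypothesis s_gt0 : forall n, 0 < s n.
Hypothesis sigma_gt0 : 0 < sigma.
Hypothesis s_cvg : s @ \oo --> sigma.
Hypothesis sg_cvg : sg @ \oo --> sigma.
Hypothesis dH : forall n (u : R), 0 < u -> derivable (H n) u 1.
Hypothesis D0 : D != 0.
Hypothesis dHD : forall e : R, 0 < e -> exists2 rho : R, 0 < rho &
  \forall n \near \oo, forall u, `|u - sigma| <= rho ->
    `|derive1 (H n) u - D| <= e.

(** Linearization of the implicit equation near [sigma]. The index threshold is chosen before [dlt],
    so a random [dlt] can be inserted point by point; the error is relative to [dlt], so it survives
    multiplication by a diverging rate. *)
Lemma closest_zero_local (eta : R) : 0 < eta ->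
  exists2 r : R, 0 < r & \forall n \near \oo, forall dlt, `|dlt| <= r ->
    `|xget 1 (closest_zero (fun u => H n (sg n) + dlt - H n u) (s n)) - sg n -
      dlt / D| <= eta * `|dlt|.
Proof.
move=> eta0.
have nD : 0 < `|D| by rewrite normr_gt0.
(* The first bound keeps the slope [A] of the sign of [D] and at least half its size. Given that,
   the second makes |D - A| / |A D| at most [eta]. *)
pose e := Num.min (`|D| / 2) (eta * (`|D| ^+ 2 / 2)).
have e0 : 0 < e by rewrite lt_min divr_gt0//= mulr_gt0// divr_gt0// exprn_gt0.
have [rho0 rho00 dHrho0] := dHD e0.
(* The cap [sigma / 2] keeps the ball around [sigma] inside the positive numbers. *)
pose rho := Num.min rho0 (sigma / 2).
have rho_gt0 : 0 < rho by rewrite lt_min rho00 divr_gt0.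
(* Over a length [rho / 4], with slope at least half of |D|, the function [H n] moves by at least
   this amount, so the perturbed value is attained within [rho / 4] of [sg n]. *)
exists (`|D| / 2 * (rho / 4)); first by rewrite mulr_gt0// divr_gt0.
near=> n => dlt dltr.
have sgn : `|sg n - sigma| <= rho / 8.
  by near: n; move/cvgrPdistC_le : sg_cvg; apply; rewrite divr_gt0.
have sn : `|s n - sigma| <= rho / 8.
  by near: n; move/cvgrPdistC_le : s_cvg; apply; rewrite divr_gt0.
have dHn u : `|u - sigma| <= rho -> `|derive1 (H n) u - D| <= e.
  move=> uI; have := near dHrho0 n; apply => //.
  by rewrite (le_trans uI)// ge_min lexx.
have pos u : `|u - sigma| <= rho -> 0 < u.
  move=> uI.
  have : rho <= sigma / 2 by rewrite ge_min lexx orbT.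
  by move: uI; rewrite ler_distl => /andP[]; lra.
have cHn u : 0 < u -> {for u, continuous (H n)}.
  move=> u0; apply: differentiable_continuous.
  by apply/derivable1_diffP; exact: dH.
have ballE u : (`|u - sigma| <= rho) = (sigma - rho <= u <= sigma + rho).
  by rewrite ler_distl.
have mvt a b : `|a - sigma| <= rho -> `|b - sigma| <= rho ->
    exists2 x, `|x - sigma| <= rho & H n b - H n a = derive1 (H n) x * (b - a).
  move=> aI bI.
  wlog ab : a b aI bI / a <= b.
    move=> wl; have [ab|/ltW ba] := leP a b; first exact: wl.
    have [x xI e'] := wl b a bI aI ba; exists x => //.
    by rewrite -opprB e'; ring.
  have ac x : x \in `[a, b] -> `|x - sigma| <= rho.
    rewrite in_itv/= => /andP[ax xb]; move: aI bI; rewrite !ballE.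
    by move=> /andP[a1 a2] /andP[b1 b2]; apply/andP; split; lra.
  have [||x xI ->] := @MVT_segment _ (H n) (fun x => derive1 (H n) x) a b ab.
  - move=> x xI; rewrite derive1E; apply: derivableP; apply/dH/pos/ac.
    exact: subset_itv_oo_cc.
  - apply: derivable_within_continuous => x xI.
    by apply/dH/pos/ac.
  by exists x => //; exact: ac.
have slope x : `|x - sigma| <= rho -> `|D| / 2 <= `|derive1 (H n) x| /\
    0 < derive1 (H n) x * D.
  move=> xI; have := dHn x xI; set y := derive1 (H n) x => yD.
  have {}yD : `|y - D| <= `|D| / 2 by rewrite (le_trans yD)// ge_min lexx.
  have [Dp|Dn] := ltP 0 D.
    move: yD; rewrite (gtr0_norm Dp) ler_distl => /andP[h1 h2].
    have y0 : 0 < y by lra.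
    by rewrite gtr0_norm// mulr_gt0//; split => //; lra.
  have {}Dn : D < 0 by rewrite lt_neqAle D0.
  move: yD; rewrite (ltr0_norm Dn) ler_distl => /andP[h1 h2].
  have y0 : y < 0 by lra.
  by rewrite ltr0_norm// nmulr_rgt0//; split => //; lra.
set y := H n (sg n) + dlt.
pose k := rho / 4.
have k0 : 0 < k by rewrite divr_gt0.
have sgI : `|sg n - sigma| <= rho by rewrite (le_trans sgn)//; lra.
have rI t : `|t - sg n| <= k -> `|t - sigma| <= rho.
  move=> tI; have -> : t - sigma = (t - sg n) + (sg n - sigma) by ring.
  rewrite (le_trans (ler_normD _ _))// (le_trans (lerD tI sgn))//.
  by rewrite /k; lra.
have [z zI Hz] : exists2 z, z \in `[sg n - k, sg n + k] & H n z = y.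
  have aI : `|sg n - k - sigma| <= rho.
    by apply: rI; rewrite addrAC subrr add0r normrN gtr0_norm.
  have bI : `|sg n + k - sigma| <= rho.
    by apply: rI; rewrite addrAC subrr add0r gtr0_norm.
  apply: IVT; first by lra.
    apply: derivable_within_continuous => x; rewrite in_itv/= => xI.
    by apply/dH/pos/rI; rewrite ler_distl.
  have [xa xaI ea] := mvt _ _ sgI aI.
  have [xb xbI eb] := mvt _ _ sgI bI.
  have [sa da] := slope _ xaI; have [sb db] := slope _ xbI.
  have {}ea : H n (sg n - k) = H n (sg n) - derive1 (H n) xa * k.
    by rewrite -[LHS](subrK (H n (sg n))) ea; ring.
  have {}eb : H n (sg n + k) = H n (sg n) + derive1 (H n) xb * k.
    by rewrite -[LHS](subrK (H n (sg n))) eb; ring.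
  rewrite ea eb /y.
  have : `|dlt| <= `|derive1 (H n) xa| * k by rewrite (le_trans dltr)// ler_pM2r.
  have : `|dlt| <= `|derive1 (H n) xb| * k by rewrite (le_trans dltr)// ler_pM2r.
  move: da db; set A := derive1 (H n) xa; set B := derive1 (H n) xb.
  have [Dp|Dn] := ltP 0 D.
    rewrite !pmulr_lgt0// => A0 B0; rewrite (gtr0_norm A0) (gtr0_norm B0).
    rewrite !ler_norml => /andP[h1 h2] /andP[h3 h4].
    by rewrite ge_min le_max !lerD2l h3 h2 orbT.
  have {}Dn : D < 0 by rewrite lt_neqAle D0.
  rewrite !nmulr_lgt0// => A0 B0; rewrite (ltr0_norm A0) (ltr0_norm B0).
  rewrite !mulNr !ler_norml !opprK => /andP[h1 h2] /andP[h3 h4].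
  by rewrite ge_min le_max !lerD2l h1 h4 orbT.
have zk : `|z - sg n| <= k by move: zI; rewrite in_itv/= ler_distl.
have cU u : 0 < u -> {for u, continuous (fun u => y - H n u)}.
  by move=> u0; apply: cvgB; [exact: cvg_cst|exact: cHn].
have Uz : y - H n z = 0 by rewrite Hz subrr.
have [x0 Ux xmin] := closest_zero_xget (s_gt0 n) cU (pos _ (rI _ zk)) Uz.
set x := xget _ _ in x0 Ux xmin *.
(* Minimality traps the selected zero where the slope is controlled: [rho / 4] for [z], plus three
   times [rho / 8] for the distances among [sg n], [sigma] and [s n]. *)
have xs : `|x - s n| <= `|z - s n|.
  by have [/ltW//|[-> _]] := xmin z (pos _ (rI _ zk)) Uz.
have xI : `|x - sigma| <= rho.
  have -> : x - sigma = (x - s n) + (s n - sigma) by ring.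
  rewrite (le_trans (ler_normD _ _))//.
  have : `|z - s n| <= k + (rho / 8 + rho / 8).
    have -> : z - s n = (z - sg n) + ((sg n - sigma) - (s n - sigma)) by ring.
    rewrite (le_trans (ler_normD _ _))// lerD//.
    by rewrite (le_trans (ler_normB _ _))// lerD.
  by rewrite /k; lra.
have [xi xiI exi] := mvt _ _ sgI xI.
have [sxi _] := slope _ xiI.
have dltE : dlt = derive1 (H n) xi * (x - sg n).
  by rewrite -exi; move: Ux; rewrite /y => Ux; lra.
set A := derive1 (H n) xi in sxi dltE.
have A0 : 0 < `|A| by rewrite (lt_le_trans _ sxi)// divr_gt0.
have AN0 : A != 0 by rewrite -normr_gt0.
have -> : x - sg n - dlt / D = dlt * ((D - A) / (A * D)).
  by rewrite dltE; field; rewrite AN0 D0.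
rewrite normrM mulrC ler_wpM2r// normrM normfV normrM distrC.
rewrite ler_pdivrMr; last by rewrite mulr_gt0.
apply: (le_trans (dHn _ xiI)); apply: (@le_trans _ _ (eta * (`|D| ^+ 2 / 2))).
  by rewrite ge_min lexx orbT.
rewrite (ler_pM2l eta0).
have -> : `|D| ^+ 2 / 2 = `|D| / 2 * `|D| by rewrite expr2; ring.
by rewrite ler_wpM2r.
Unshelve. all: by end_near. Qed.

End closest_zero_local.

(** * Measurability of the closest zero *)

Section measurable_closest_zero.
Context d (T : measurableType d) (R : realType) (U : T -> R -> R) (s : T -> R).
Hypothesis mU : forall c : T -> R, measurable_fun [set: T] c ->
  (forall x, 0 < c x) -> measurable_fun [set: T] (fun x => U x (c x)).
Hypothesis cU : forall x (u : R), 0 < u -> {for u, continuous (U x)}.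
Hypothesis ms : measurable_fun [set: T] s.
Hypothesis s_gt0 : forall x, 0 < s x.

Let msetI_le (f g : T -> R) : measurable_fun [set: T] f ->
  measurable_fun [set: T] g -> measurable [set x | f x <= g x].
Proof.
move=> mf mg; have := measurable_fun_ler mf mg.
by move=> /(_ measurableT [set true] I); rewrite setTI.
Qed.

(** By compactness, a continuous function vanishes somewhere on a segment exactly when it takes
    arbitrarily small absolute values at countably many test points. The test points are rationals
    clamped to the segment: it may be a single irrational point, and [U] may only be evaluated along
    positive measurable functions. *)
Lemma measurable_zero_between (a b : T -> R) : measurable_fun [set: T] a ->
  measurable_fun [set: T] b -> (forall x, 0 < a x) ->
  measurable [set x | exists u, a x <= u <= b x /\ U x u = 0].
Proof.
move=> ma mb a0.
pose c (q : rat) x := Num.max (a x) (Num.min (b x) (ratr q)).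
have mc q : measurable_fun [set: T] (c q).
  by apply: measurable_maxr => //; exact: measurable_minr.
have ac q x : a x <= c q x by rewrite le_max lexx.
have c0 q x : 0 < c q x by exact: (lt_le_trans (a0 x)).
rewrite (_ : [set x | _] = [set x | a x <= b x] `&`
    \bigcap_k \bigcup_(q in [set: rat]) [set x | `|U x (c q x)| <= k.+1%:R^-1]).
  apply: measurableI; first exact: msetI_le.
  apply: bigcapT_measurable => k; apply: bigcupT_measurable_rat => q.
  apply: msetI_le; last exact: measurable_cst.
  by apply: measurableT_comp => //; exact: mU.
apply/seteqP; split=> [x [u [/andP[au ub] Uu]]|x [ab small]].
  have ab : a x <= b x by exact: le_trans ub.
  split=> // k _.
  have /cvgrPdist_le/(_ k.+1%:R^-1) := @cU x u (lt_le_trans (a0 x) au).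
  rewrite invr_gt0 ltr0n => /(_ isT)/nbhs_ballP[e /= e0 near_u].
  have /rat_in_itvoo[q] : u - e < u + e by lra.
  rewrite in_itv/= => /andP[q1 q2]; exists q => //=.
  rewrite -normrN -[X in `|X|]add0r -Uu; apply: near_u; rewrite /ball/=.
  have : `|u - ratr q| < e by rewrite distrC ltr_distl q1.
  apply: le_lt_trans; rewrite /c.
  have [bq|qb] := leP (b x) (ratr q).
    have -> : Num.max (a x) (b x) = b x by exact/max_idPr.
    by rewrite !ler0_norm ?subr_le0 ?(le_trans ub)// lerN2 lerD2l lerN2.
  have [aq|qa] := leP (a x) (ratr q) => //.
  by rewrite !ger0_norm ?subr_ge0 ?(ltW (lt_le_trans qa au))// lerD2l lerN2 ltW.
have cf : {within `[a x, b x], continuous (fun u => `|U x u|)}.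
  apply: continuous_in_subspaceT => u /set_mem/=.
  rewrite in_itv/= => /andP[au _]; apply: cvg_norm; apply: cU.
  exact: (lt_le_trans (a0 x)).
have [u uI umin] := EVT_min ab cf.
exists u; split; first by move: uI; rewrite in_itv.
apply/eqP; rewrite -normr_le0; apply/ler_addgt0Pl => e e0; rewrite addr0.
have [k ke] : exists k, k.+1%:R^-1 <= e.
  exists (Num.truncn e^-1).
  rewrite -[leRHS]invrK lef_pV2 ?posrE ?invr_gt0 ?ltr0n//.
  by rewrite ltW// truncnS_gt.
have [q _ /= Uq] := small k I.
rewrite (le_trans _ ke)// (le_trans _ Uq)//; apply: umin.
by rewrite in_itv/= ac/= /c ge_max ab ge_min lexx.
Qed.

Let inv_lt (e : R) : 0 < e -> exists k : nat, k.+1%:R^-1 <= e.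
Proof.
move=> e0; exists (Num.truncn e^-1).
rewrite -[leRHS]invrK lef_pV2 ?posrE ?invr_gt0 ?ltr0n//.
by rewrite ltW// truncnS_gt.
Qed.

(** The strict conditions become a countable union of closed ones with margin 1/(k+1), which gives
    segments bounded away from 0. *)
Let mzero_gt (c q : R) : measurable
  [set x | exists u, [/\ 0 < u, U x u = 0, c < u & `|u - s x| <= q]].
Proof.
rewrite (_ : [set x | _] = \bigcup_k [set x | exists u,
    Num.max (k.+1%:R^-1) (Num.max (c + k.+1%:R^-1) (s x - q)) <= u <= s x + q
    /\ U x u = 0]).
  apply: bigcupT_measurable => k; apply: measurable_zero_between.
  - apply: measurable_maxr; first exact: measurable_cst.
    apply: measurable_maxr; first exact: measurable_cst.
    by apply: measurable_funB => //; exact: measurable_cst.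
  - by apply: measurable_funD => //; exact: measurable_cst.
  - by move=> x; rewrite lt_max invr_gt0 ltr0n.
apply/seteqP; split=> x /=.
  move=> [u [u0 Uu cu]]; rewrite ler_distl => /andP[h1 h2].
  have /inv_lt[k] : 0 < Num.min u (u - c) by rewrite lt_min u0 subr_gt0.
  rewrite le_min => /andP[k1 k2].
  exists k => //; exists u; split=> //.
  by rewrite !ge_max k1 h1 h2 -lerBrDl k2.
move=> [k _ [u [/andP[]]]]; rewrite !ge_max => /andP[h1 /andP[h2 h3]] h4 Uu.
have k0 : 0 < k.+1%:R^-1 :> R by rewrite invr_gt0 ltr0n.
exists u; split => //.
- exact: (lt_le_trans k0).
- by rewrite (lt_le_trans _ h2)// ltrDl.
- by rewrite ler_distl h3.
Qed.

Let mzero_le (c q : R) : measurable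
  [set x | exists u, [/\ 0 < u, U x u = 0, u <= c & `|u - s x| <= q]].
Proof.
rewrite (_ : [set x | _] = \bigcup_k [set x | exists u,
    Num.max (k.+1%:R^-1) (s x - q) <= u <= Num.min c (s x + q) /\ U x u = 0]).
  apply: bigcupT_measurable => k; apply: measurable_zero_between.
  - apply: measurable_maxr; first exact: measurable_cst.
    by apply: measurable_funB => //; exact: measurable_cst.
  - apply: measurable_minr; first exact: measurable_cst.
    by apply: measurable_funD => //; exact: measurable_cst.
  - by move=> x; rewrite lt_max invr_gt0 ltr0n.
apply/seteqP; split=> x /=.
  move=> [u [u0 Uu uc]]; rewrite ler_distl => /andP[h1 h2].
  have [k k1] := inv_lt u0.
  exists k => //; exists u; split=> //.
  by rewrite ge_max le_min k1 h1 h2 uc.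
move=> [k _ [u [/andP[]]]]; rewrite ge_max le_min => /andP[h1 h2] /andP[h3 h4] Uu.
have k0 : 0 < k.+1%:R^-1 :> R by rewrite invr_gt0 ltr0n.
by exists u; split => //; [exact: (lt_le_trans k0)|rewrite ler_distl h2].
Qed.

Let mzero : measurable [set x | exists u, 0 < u /\ U x u = 0].
Proof.
rewrite (_ : [set x | _] = \bigcup_k [set x | exists u,
    (k.+1%:R^-1 : R) <= u <= k%:R /\ U x u = 0]).
  apply: bigcupT_measurable => k; apply: measurable_zero_between.
  - exact: measurable_cst.
  - exact: measurable_cst.
  - by move=> x; rewrite invr_gt0 ltr0n.
apply/seteqP; split=> x /=.
  move=> [u [u0 Uu]].
  have [k k1] := inv_lt u0.
  exists (maxn k (Num.truncn u).+1) => //; exists u; split=> //.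
  apply/andP; split.
    rewrite (le_trans _ k1)// lef_pV2 ?posrE ?ltr0n// ler_nat ltnS.
    exact: leq_maxl.
  rewrite (le_trans (ltW (truncnS_gt u)))// ler_nat.
  exact: leq_maxr.
move=> [k _ [u [/andP[h _] Uu]]]; exists u; split=> //.
by apply: lt_le_trans h; rewrite invr_gt0 ltr0n.
Qed.

Lemma measurable_closest_zero :
  measurable_fun [set: T] (fun x => xget 1 (closest_zero (U x) (s x))).
Proof.
move=> mD; apply: (measurability _ (RGenOInfty.measurableE R)) => //.
move=> /= _ [_ [c ->] <-]; rewrite preimage_itvoy setTI.
(* The closest zero exceeds c iff, for some rational q, there is a zero > c but
   no zero <= c within distance q of s. *)
rewrite (_ : [set x | _] =
  (\bigcup_(q in [set: rat])
    ([set x | exists u, [/\ 0 < u, U x u = 0, c < u & `|u - s x| <= ratr q]] `\`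
     [set x | exists u, [/\ 0 < u, U x u = 0, u <= c & `|u - s x| <= ratr q]]))
  (* Without a zero the value is the default 1. *)
  `|` (~` [set x | exists u, 0 < u /\ U x u = 0] `&` [set x | c < 1])).
  apply: measurableU.
    by apply: bigcupT_measurable_rat => q; apply: measurableD.
  apply: measurableI; first exact: measurableC.
  apply: (@measurable_set_ltr _ _ _ (fun=> c) (fun=> 1));
    exact: measurable_cst.
apply/seteqP; split=> x /=.
  have [[z [z0 Uz]]|noZ] := pselect (exists u, 0 < u /\ U x u = 0); last first.
    rewrite xgetPN; first by move=> c1; right.
    by move=> u [u0 Uu _]; apply: noZ; exists u.
  have := closest_zero_xget (s_gt0 x) (@cU x) z0 Uz.
  set u := xget _ _ => -[u0 Uu umin] cu; left.
  have [[z' [[z'0 Uz'] z'c]]|noZ] :=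
      pselect ([set u | 0 < u /\ U x u = 0] `&` [set u | u <= c] !=set0); last first.
    have /rat_in_itvoo[q] : `|u - s x| < `|u - s x| + 1 by rewrite ltrDl.
    rewrite in_itv/= => /andP[q1 _]; exists q => //; split.
      by exists u; split=> //; rewrite ltW.
    by move=> [v [v0 Uv vc _]]; apply: noZ; exists v.
  have [||||v [[v0 Uv] /= vc] vmin] :=
      @closest_point _ ([set u | 0 < u /\ U x u = 0] `&` [set u | u <= c]) (s x).
  - exact: s_gt0.
  - by move=> v [[]].
  - apply: closed_in_posI; first exact: (closed_in_pos_zeros (@cU x)).
    exact: closed_le.
  - by exists z'.
  (* The inequality is strict because a tie is resolved in favour of the smaller zero: it would give
     [u <= v <= c]. *)
  have /rat_in_itvoo[q] : `|u - s x| < `|v - s x|.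
    have [//|[_ uv]] := umin v v0 Uv.
    by have := lt_le_trans cu (le_trans uv vc); rewrite ltxx.
  rewrite in_itv/= => /andP[q1 q2]; exists q => //; split.
    by exists u; split=> //; rewrite ltW.
  move=> [v' [v'0 Uv' v'c v's]].
  have := le_trans (vmin v' (conj (conj v'0 Uv') v'c)) v's.
  by rewrite leNgt q2.
move=> [[q _ [[v [v0 Uv cv vq]] noZ]]|[noZ c1]]; last first.
  rewrite xgetPN// => u [u0 Uu _]; apply: noZ; by exists u.
have := closest_zero_xget (s_gt0 x) (@cU x) v0 Uv.
set u := xget _ _ => -[u0 Uu umin].
rewrite ltNge; apply/negP => uc; apply: noZ; exists u; split => //.
by apply: le_trans vq; have [/ltW|[->]] := umin v v0 Uv.
Qed.

End measurable_closest_zero.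

(** * From random to deterministic parameters *)

(* Turns failures at arbitrarily late indices, arbitrarily deep in the
   neighbourhoods [V k], into failures along one sequence that is eventually in
   every [V k]. *)
Lemma select_sequence (A : Type) (V : nat -> set A) (bad : nat -> set A)
    (dflt : nat -> A) :
  (forall j k, (j <= k)%N -> V k `<=` V j) ->
  (forall n, V 0 (dflt n)) -> (forall k, \forall n \near \oo, V k (dflt n)) ->
  (forall k, exists n a, [/\ (k <= n)%N, V k a & bad n a]) ->
  exists t : nat -> A, [/\ forall n, V 0 (t n),
    forall k, \forall n \near \oo, V k (t n) &
    forall N, exists2 n, (N <= n)%N & bad n (t n)].
Proof.
move=> Vanti V0 Vdflt ex_bad.
have /choice[na naP] : forall k, exists na : nat * A,
    [/\ (k <= na.1)%N, V k na.2 & bad na.1 na.2].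
  by move=> k; have [n [a h]] := ex_bad k; exists (n, a).
have /choice[t tP] : forall n, exists a,
    (exists j, (na j).1 = n /\ a = (na j).2) \/
    ((forall j, (na j).1 <> n) /\ a = dflt n).
  move=> n; have [[j jn]|nj] := pselect (exists j, (na j).1 = n).
    by exists (na j).2; left; exists j.
  by exists (dflt n); right; split=> // j jn; apply: nj; exists j.
exists t; split.
- move=> n; case: (tP n) => [[j [_ ->]]|[_ ->]] //.
  by have [_ h _] := naP j; exact: (Vanti _ _ (leq0n j)).
- move=> k; near=> n.
  case: (tP n) => [[j [jn ->]]|[_ ->]]; last by near: n; exact: Vdflt.
  have [_ h _] := naP j; apply: Vanti h.
  rewrite leqNgt; apply/negP => jk.
  (* Only the finitely many selections numbered below [k] may miss [V k]; [n] is taken beyond all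
     their indices. *)
  have : (\max_(i < k) (na i).1 < n)%N by near: n; exact: nbhs_infty_gt.
  by apply/negP; rewrite -leqNgt -jn (leq_bigmax (Ordinal jk)).
- move=> N; have [Nn _ _] := naP N; exists (na N).1 => //.
  case: (tP (na N).1) => [[j [jn ->]]|[/(_ N)//]].
  by have [_ _] := naP j; rewrite jn.
Unshelve. all: by end_near. Qed.

Lemma Rexp_indic d (T : measurableType d) (R : realType) (P : probability T R)
    (A : set T) : measurable A -> \int[P]_w (\1_A w : R) = fine (P A).
Proof. by move=> mA; rewrite /Rintegral integral_indic// setIT. Qed.

Lemma bounded_rv_indic d (T : measurableType d) (R : realType) (A : set T) :
  measurable A -> bounded_rv (\1_A : T -> R).
Proof.
move=> mA; apply: (@bounded_rvW _ _ _ 1); first exact: measurable_indic.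
by move=> w; rewrite indicE; case: (_ \in _); rewrite ?normr1 ?normr0.
Qed.

Section random_parameters.
Context (R : realType) (d : nat -> measure_display)
  (T : forall n, measurableType (d n)) (P : forall n, probability (T n) R)
  (S Q : forall n, T n -> R) (sigma : R).
Hypothesis mS : forall n, measurable_fun [set: T n] (@S n).
Hypothesis S_gt0 : forall n w, 0 < @S n w.
Hypothesis sigma_gt0 : 0 < sigma.
Hypothesis S_cvg : cvg_in_probability P S sigma.
Hypothesis Q_tight : tight_laws P Q.

(** Convergence along every admissible sequence forces uniform closeness of [G n] to [L] on a small
    neighbourhood of [sigma] times a bounded set, for late [n]: otherwise the bad points would
    assemble into one offending sequence. Unlike sequential convergence, uniform closeness can be
    integrated. *)
Lemma cvg_Rexp_random_parameters (G : nat -> R * R -> R) (L B : R) :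
  (forall n, bounded_rv (fun w => G n (@S n w, @Q n w))) ->
  (forall n z, `|G n z| <= B) ->
  (forall t q : nat -> R, cvg_pos t sigma -> bounded_fun q ->
    G n (t n, q n) @[n --> \oo] --> L) ->
  \int[P n]_w G n (@S n w, @Q n w) @[n --> \oo] --> L.
Proof.
move=> bG GB GL; apply/cvgrPdistC_le => e e0.
(* [C] bounds |G - L| everywhere, so each of the two exceptional events, of probability at most
   [e / 4 / C], costs at most [e / 4]. *)
pose C := `|B| + `|L| + 1.
have C0 : 0 < C by rewrite ltr_wpDl// addr_ge0.
have e4C : 0 < e / 4 / C by rewrite !divr_gt0.
have [mQ] := Q_tight; move=> /(_ _ e4C)[K [cK QK]].
have [M [_ KM]] := compact_bounded cK.
pose M' := `|M| + 1.
have {}KM q : K q -> `|q| <= M'.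
  by move=> Kq; apply: (KM M') => //; rewrite (le_lt_trans (ler_norm _))// ltrDl.
(* [V 0] holds what is required at every index. Since the inverse of 0 is 0, the guard [0 < k] is
   what keeps [V 0] from forcing [z.1 = sigma]. *)
pose V (k : nat) := [set z : R * R | [/\ 0 < z.1,
  (0 < k)%N -> `|z.1 - sigma| <= k%:R^-1 & `|z.2| <= M']].
have [k kP] : exists k, forall n z, (k <= n)%N -> V k z ->
    `|G n z - L| <= e / 2.
  apply: contrapT => noK.
  have [||||t [tpos tV tbad]] := @select_sequence (R * R)%type V
      (fun n => [set z | e / 2 < `|G n z - L|]) (fun=> (sigma, 0)).
  - move=> j k jk z [z0 zk zM]; split=> // j0.
    have k0 := leq_trans j0 jk.
    rewrite (le_trans (zk k0))// lef_pV2 ?posrE ?ltr0n//.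
    by rewrite ler_nat.
  - by move=> n; split=> //=; rewrite normr0 addr_ge0.
  - move=> k; apply: nearW => n; split=> //=.
      by rewrite subrr normr0 invr_ge0.
    by rewrite normr0 addr_ge0.
  - move=> k; apply: contrapT => nok; apply: noK; exists k => n z kn Vz.
    by rewrite leNgt; apply/negP => bz; apply: nok; exists n, z.
  have ct : cvg_pos (fun n => (t n).1) sigma.
    split=> //; first by move=> n; have [] := tpos n.
    apply/cvgrPdistC_le => eta eta0.
    have := tV (Num.truncn eta^-1).+1; apply: filterS => n [_ /(_ isT) h _].
    apply: (le_trans h).
    rewrite -[leRHS]invrK lef_pV2 ?posrE ?invr_gt0 ?ltr0n//.
    by rewrite ltW// truncnS_gt.
  have bq : bounded_fun (fun n => (t n).2).
    exists M'; split; first exact: num_real.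
    move=> x Mx n _ /=; have [_ _ h] := tpos n.
    by rewrite (le_trans h)// ltW.
  have /cvgrPdistC_le/(_ (e / 2)) := GL _ _ ct bq.
  rewrite divr_gt0// => /(_ isT)[N _ NP].
  have [n /NP/= + bn] := tbad N.
  rewrite -surjective_pairing => h.
  by have := lt_le_trans bn h; rewrite ltxx.
have k1 : 0 < k.+1%:R^-1 :> R by rewrite invr_gt0 ltr0n.
have := S_cvg k1 => /fine_cvgP[_].
move=> /cvgr0Pnorm_le/(_ _ e4C) near_S.
near=> n.
have PAn : `|fine (P n [set w | k.+1%:R^-1 < `|@S n w - sigma|])| <= e / 4 / C.
  by near: n; exact: near_S.
pose A := [set w | k.+1%:R^-1 < `|@S n w - sigma|].
have mA : measurable A.
  have mSs : measurable_fun [set: T n] (fun w => `|@S n w - sigma|).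
    apply: measurableT_comp => //; apply: measurable_funB; first exact: mS.
    exact: measurable_cst.
  have mc : measurable_fun [set: T n] (fun=> k.+1%:R^-1 : R).
    exact: measurable_cst.
  exact: (measurable_set_ltr mc mSs).
pose D := @Q n @^-1` (~` K).
have mD : measurable D.
  rewrite -[D]setTI; apply: mQ => //; apply: measurableC.
  by apply: closed_measurable; apply: compact_closed => //; exact: Rhausdorff.
have GLC w : `|G n (@S n w, @Q n w) - L| <= C.
  rewrite (le_trans (ler_normB _ _))// /C -addrA lerD//.
    by rewrite (le_trans (GB n _))// ler_norm.
  by rewrite lerDl.
have pt w : `|G n (@S n w, @Q n w) - L| <=
    e / 2 + (C * \1_A w + C * \1_D w).
  rewrite !indicE; have [wA|wA] := boolP (w \in A).
    rewrite mulr1 (le_trans (GLC w))// addrCA lerDl addr_ge0//.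
      by rewrite divr_ge0// ltW.
    by rewrite mulr_ge0// ltW.
  have [wD|wD] := boolP (w \in D).
    by rewrite mulr0 mulr1 add0r (le_trans (GLC w))// lerDr divr_ge0 ?ltW.
  rewrite !mulr0 !addr0; apply: kP; first by near: n; exact: nbhs_infty_ge.
  move: wA wD; rewrite !notin_setE /A /D /= => /negP; rewrite -leNgt => wA.
  move=> /contrapT/KM wD; split=> //= k0.
  by rewrite (le_trans wA)// lef_pV2 ?posrE ?ltr0n// ler_nat.
have bA : bounded_rv (\1_A : T n -> R) by exact: bounded_rv_indic.
have bD : bounded_rv (\1_D : T n -> R) by exact: bounded_rv_indic.
have bC := @bounded_rv_cst _ (T n) _ C.
have be := @bounded_rv_cst _ (T n) _ (e / 2).
have bCA : bounded_rv (fun w => C * \1_A w) by exact: bounded_rvM.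
have bCD : bounded_rv (fun w => C * \1_D w) by exact: bounded_rvM.
rewrite -(Rexp_cst (P n) L) -RexpB//; last exact: bounded_rv_cst.
apply: (@le_trans _ _ (\int[P n]_w (e / 2 + (C * \1_A w + C * \1_D w)))).
  apply: le_norm_Rexp => //; first by apply: bounded_rvB => //; exact: bounded_rv_cst.
  by apply: bounded_rvD => //; exact: bounded_rvD.
rewrite RexpD//; last exact: bounded_rvD.
rewrite RexpD// Rexp_cst !RexpZ// !Rexp_indic//.
have PA : C * fine (P n A) <= e / 4.
  rewrite mulrC -ler_pdivlMr//.
  exact: (le_trans (ler_norm _)).
have PD : C * fine (P n D) <= e / 4.
  rewrite mulrC -ler_pdivlMr// -lee_fin fineK; first exact: QK.
  exact: fin_num_measure.
by lra.
Unshelve. all: by end_near. Qed.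

End random_parameters.

(** This form of tightness is a convergence statement for each fixed sequence [k], hence accessible
    to the passage from fixed to random parameters. Each single law is tight, so a failure of
    uniform tightness must occur at arbitrarily late indices and yields a bad sequence [k]. *)
Lemma tight_lawsP (R : realType) (d : nat -> measure_display)
    (T : forall n, measurableType (d n)) (P : forall n, probability (T n) R)
    (X : forall n, T n -> R) :
  (forall n, measurable_fun [set: T n] (@X n)) ->
  (forall k : nat -> nat, k @ \oo --> \oo ->
    fine (P n [set w | (k n)%:R < `|X n w|]) @[n --> \oo] --> 0) ->
  tight_laws P X.
Proof.
move=> mX kX; split=> // e e0.
pose tl n (k : nat) := [set w | k%:R < `|@X n w|].
have mXk n (k : nat) : measurable (tl n k).
  have mXn : measurable_fun [set: T n] (fun w => `|X n w|).
    by apply: measurableT_comp => //; exact: mX.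
  have mc : measurable_fun [set: T n] (fun=> k%:R : R).
    exact: measurable_cst.
  exact: (measurable_set_ltr mc mXn).
have anti n j k : (j <= k)%N ->
    (P n (tl n k) <= P n (tl n j))%E.
  move=> jk; apply: le_measure; rewrite ?inE; [exact: mXk..|].
  by move=> w /=; apply: le_lt_trans; rewrite ler_nat.
have single n : exists c : nat, (P n (tl n c) <= e%:E)%E.
  have : P n (tl n k) @[k --> \oo] --> P n set0.
    have -> : set0 = \bigcap_k (tl n k).
      apply/esym/seteqP; split=> // w /(_ (Num.truncn `|X n w|).+1 I) /=.
      by apply/negP; rewrite -leNgt ltW// truncnS_gt.
    apply: nonincreasing_cvg_mu => //.
    - by rewrite (le_lt_trans (probability_le1 _ _)) ?ltry.
    - exact: bigcapT_measurable.
    - move=> j k jk; apply/subsetPset => w /=; apply: le_lt_trans.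
      by rewrite ler_nat.
  rewrite measure0 => /fine_cvgP[_] /cvgr0Pnorm_le/(_ _ e0)[c _ cP].
  exists c; rewrite -[leLHS]fineK ?fin_num_measure// lee_fin.
  by rewrite (le_trans (ler_norm _))//; exact: (cP c (leqnn c)).
have [K KP] : exists K : nat, forall n,
    (P n (tl n K) <= e%:E)%E.
  apply: contrapT => noK.
  have [c cP] := choice single.
  have [||||t [_ t_oo tbad]] := @select_sequence nat (fun k => [set j | (k <= j)%N])
      (fun n => [set k | (e%:E < P n (tl n k))%E]) id.
  - by move=> j k jk i /=; exact: leq_trans.
  - by [].
  - by move=> k; exact: nbhs_infty_ge.
  (* [K] dominates the thresholds [c i] of all indices below [k], so an index at which [K] fails is
     at least [k]. *)
  - move=> k; pose K := maxn k (\max_(i < k) c i).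
    have [n Pn] : exists n, (e%:E < P n (tl n K))%E.
      apply: contrapT => noN; apply: noK; exists K => n.
      by rewrite leNgt; apply/negP => h; apply: noN; exists n.
    exists n, K; split => //=; last exact: leq_maxl.
    rewrite leqNgt; apply/negP => nk.
    have cK : (c n <= K)%N.
      by rewrite (leq_trans _ (leq_maxr _ _))// (leq_bigmax (Ordinal nk)).
    by have := lt_le_trans Pn (le_trans (anti n _ _ cK) (cP n)); rewrite ltxx.
  have t_cvg : t @ \oo --> \oo by apply/cvgnyPge => k; exact: t_oo.
  have /cvgr0Pnorm_le/(_ _ e0)[N _ NP] := kX t t_cvg.
  have [n /NP/= h] := tbad N.
  rewrite /= -[ltRHS]fineK ?fin_num_measure// lte_fin => h'.
  by have := lt_le_trans h' (le_trans (ler_norm _) h); rewrite ltxx.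
exists `[- K%:R, K%:R]%classic; split; first exact: segment_compact.
move=> n; have := KP n; apply: le_trans.
rewrite (_ : _ @^-1` _ = (tl n K))//.
apply/seteqP; split=> w /=; rewrite in_itv/= -ler_norml.
  by move=> /negP; rewrite -ltNge.
by move=> h; apply/negP; rewrite -ltNge.
Qed.

(** * The estimator at deterministic parameters *)

Lemma Rexp_identically_distributed d (T : measurableType d) (R : realType)
    (P : probability T R) m (X : 'I_m -> T -> R) (k : R -> R) i j :
  (forall i, measurable_fun [set: T] (X i)) -> identically_distributed P X ->
  @bounded_rv _ (measurableTypeR R) R k ->
  \int[P]_w k (X i w) = \int[P]_w k (X j w).
Proof.
move=> mX idX bk.
pose Y l : {RV P >-> R} :=
  HB.pack (X l) (@isMeasurableFun.Build _ _ _ _ (X l) (mX l)).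
transitivity (\int[distribution P (Y i)]_y k y).
  by rewrite Rintegral_distribution.
rewrite -(Rintegral_distribution (Y j) bk); congr fine.
by apply: eq_measure_integral => A mA _; exact: idX.
Qed.

Section deterministic_parameters.
Context (R : realType) (p : nat -> nat) (p_gt0 : forall n, (0 < p n)%N)
  (d : nat -> measure_display) (T : forall n, measurableType (d n))
  (P : forall n, probability (T n) R) (chi : forall n, 'I_(p n) -> T n -> R)
  (f H : nat -> R -> R) (t sg : nat -> R) (sigma D C F0 F2 : R)
  (w : nat -> R).
Hypothesis p_oo : p @ \oo --> \oo.
Hypothesis mchi : forall n i, measurable_fun [set: T n] (@chi n i).
Hypothesis indep_chi : forall n, mutually_independent (P n) (@chi n).
Hypothesis id_chi : forall n, identically_distributed (P n) (@chi n).
Hypothesis mf : forall n, measurable_fun [set: R] (f n).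
Hypothesis f4 : forall n x, `|f n x| ^+ 4 <= C * (p n)%:R.
Hypothesis t_gt0 : forall n, 0 < t n.
Hypothesis sigma_gt0 : 0 < sigma.
Hypothesis t_cvg : t @ \oo --> sigma.
Hypothesis sg_cvg : sg @ \oo --> sigma.
Hypothesis dH : forall n (u : R), 0 < u -> derivable (H n) u 1.
Hypothesis D0 : D != 0.
Hypothesis dHD : forall e : R, 0 < e -> exists2 rho : R, 0 < rho &
  \forall n \near \oo, forall u, `|u - sigma| <= rho ->
    `|derive1 (H n) u - D| <= e.

Let F n := obs_mean (P n) (p_gt0 n) (@chi n) (f n).
Hypothesis H_cvg : H n (sg n) @[n --> \oo] --> F0.
Hypothesis F2_cvg :
  obs_mean (P n) (p_gt0 n) (@chi n) (fun x => f n x ^+ 2) @[n --> \oo] --> F2.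
Hypothesis w_oo : w @ \oo --> +oo.
Variable Cb : R.
Hypothesis w_bias : forall n, w n * `|F n - H n (sg n)| <= Cb.

Let sp n : R := Num.sqrt (p n)%:R.
Let mean n (o : T n) : R := (p n)%:R^-1 * \sum_i f n (@chi n i o).
Let est n (o : T n) : R :=
  xget 1 (closest_zero (fun u => mean o - H n u) (t n)).
(** Dividing by [D] as well as by [sp n] makes [W] the leading term of [sp n * (est - sg n)]. *)
Let g n x := (f n x - F n) / (sp n * D).
Let W n (o : T n) := \sum_i g n (@chi n i o).
Let V n := \int[P n]_o (W o ^+ 2).
Let b n := F n - H n (sg n).

Let spp n : 0 < sp n.
Proof. by rewrite sqrtr_gt0 ltr0n. Qed.

Let sp2 n : sp n ^+ 2 = (p n)%:R.
Proof. by rewrite sqr_sqrtr. Qed.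

Let p_oo' : (p n)%:R @[n --> \oo] --> (+oo%R : set_system R).
Proof. exact/cvgrnyP. Qed.

Let sp_oo : sp @ \oo --> +oo.
Proof.
apply/cvgryPge => M; have /cvgryPge/(_ (M ^+ 2)) := p_oo'.
apply: filterS => n; rewrite -sp2 => h.
have [M0|M0] := leP 0 M; last by rewrite (le_trans (ltW M0))// ltW.
by rewrite -(@ler_pXn2r _ 2)// nnegrE// ltW.
Qed.

Let isp0 : (sp n)^-1 @[n --> \oo] --> 0.
Proof. by apply/gtr0_cvgV0; [exact: nearW|exact: sp_oo]. Qed.

Let C_ge0 : 0 <= C.
Proof.
have := f4 0 0; have := p_gt0 0; rewrite -(ltr0n R) => p0 /(le_trans _) h.
by rewrite -(pmulr_lge0 _ p0) h// exprn_ge0.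
Qed.

(** The fourth root of [C * (p n)%:R]. Divided by [sp n], it makes the normalized summands of order
    p_n^(-1/4). *)
Let M n := Num.sqrt (Num.sqrt C) * Num.sqrt (sp n).

Let M_ge0 n : 0 <= M n.
Proof. by rewrite mulr_ge0// sqrtr_ge0. Qed.

Let fM n x : `|f n x| <= M n.
Proof.
rewrite -(@ler_pXn2r _ 4)// ?nnegrE//; apply: le_trans (f4 n x) _.
by rewrite exprMn -[4%N]/(2 * 2)%N !exprM !sqr_sqrtr ?sqrtr_ge0.
Qed.

Let bf n : @bounded_rv _ (measurableTypeR R) R (f n).
Proof. exact: (bounded_rvW (mf n) (fM n)). Qed.

Let bfchi n i : bounded_rv (fun o => f n (@chi n i o)).
Proof. exact: (bounded_rv_comp (mf n) (fM n) (@mchi n i)). Qed.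

Let FE n i : \int[P n]_o f n (@chi n i o) = F n.
Proof.
rewrite /F /obs_mean fine_expectation.
exact: (Rexp_identically_distributed _ _ (@mchi n) (@id_chi n) (bf n)).
Qed.

Let FM n : `|F n| <= M n.
Proof. by rewrite -(FE (Ordinal (p_gt0 n))); exact: le_norm_Rexp_cst. Qed.

Let dl n := 2 * M n / (sp n * `|D|).

Let spD n : 0 < sp n * `|D|.
Proof. by rewrite mulr_gt0// normr_gt0. Qed.

Let gdl n x : `|g n x| <= dl n.
Proof.
rewrite /g normrM normfV normrM (gtr0_norm (spp n)) ler_pM2r ?invr_gt0//.
by rewrite (le_trans (ler_normB _ _))// mulr2n mulrDl mul1r lerD.
Qed.

Let dl_cvg : dl @ \oo --> 0.
Proof.
pose c := 2 * Num.sqrt (Num.sqrt C) / `|D|.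
have -> : dl = fun n => c * Num.sqrt (sp n)^-1.
  apply/funext => n; rewrite /dl /M sqrtrV ?ltW// /c.
  have spE : sp n = Num.sqrt (sp n) * Num.sqrt (sp n).
    by rewrite -expr2 sqr_sqrtr ?ltW.
  rewrite [X in _ / (X * _)]spE; field.
  by rewrite normr_eq0 D0 gt_eqF// sqrtr_gt0.
rewrite -(mulr0 c); apply: cvgM; first exact: cvg_cst.
rewrite -[X in _ --> X]sqrtr0.
by apply: continuous_cvg => //; exact: sqrt_continuous.
Qed.

Let mg n : measurable_fun [set: R] (g n).
Proof.
apply: measurable_funM; last exact: measurable_cst.
by apply: measurable_funB; [exact: mf|exact: measurable_cst].
Qed.

Let g0 n i : \int[P n]_o g n (@chi n i o) = 0.
Proof.
rewrite /g; under eq_Rintegral do rewrite mulrC.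
rewrite RexpZ; last by apply: bounded_rvB => //; exact: bounded_rv_cst.
rewrite RexpB//; last exact: bounded_rv_cst.
by rewrite FE Rexp_cst subrr mulr0.
Qed.

Let bW n : bounded_rv (@W n).
Proof. exact: (bounded_rv_centered_sum (@mchi n) (mg n) (@gdl n)). Qed.

Let v := (F2 - F0 ^+ 2) / D ^+ 2.

Let b_cvg : b @ \oo --> 0.
Proof.
apply/cvgr0Pnorm_le => e e0; near=> n.
have w0 : 0 < w n by near: n; move/cvgryPgt : w_oo; exact.
have wC : (`|Cb| + 1) / e <= w n by near: n; move/cvgryPge : w_oo; exact.
rewrite -(ler_pM2l w0) (le_trans (w_bias n))//.
move: wC; rewrite ler_pdivrMr// => /(le_trans _); apply.
by rewrite (le_trans (ler_norm _))// lerDl.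
Unshelve. all: by end_near. Qed.

(** The limit is only given for [H n (sg n)]; the vanishing bias transfers it to the mean, as the
    variance limit requires. *)
Let F_cvg : F @ \oo --> F0.
Proof.
have -> : F = fun n => b n + H n (sg n) by apply/funext => n; rewrite /b subrK.
by rewrite -[F0]add0r; exact: cvgD.
Qed.

Let V_cvg : V @ \oo --> v.
Proof.
pose F2n n := obs_mean (P n) (p_gt0 n) (@chi n) (fun x => f n x ^+ 2).
have -> : V = fun n => (F2n n - F n ^+ 2) / D ^+ 2.
  apply/funext => n.
  rewrite /V (variance_centered_sum (@mchi n) (@indep_chi n) (mg n) (@gdl n)
    (@g0 n)).
  have bf2 i : bounded_rv (fun o => f n (@chi n i o) ^+ 2) by exact: bounded_rvX.
  have gi i : \int[P n]_o (g n (@chi n i o) ^+ 2) =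
      (sp n * D) ^- 2 * (F2n n - F n ^+ 2).
    transitivity (\int[P n]_o ((sp n * D) ^- 2 * (f n (@chi n i o) ^+ 2 +
        ((- 2 * F n) * f n (@chi n i o) + F n ^+ 2)))).
      apply: eq_Rintegral => o _; rewrite /g; field.
      by rewrite D0 gt_eqF.
    have b1 : bounded_rv (fun o => - 2 * F n * f n (@chi n i o)).
      by apply: bounded_rvM => //; exact: bounded_rv_cst.
    have b2 : bounded_rv (fun o => - 2 * F n * f n (@chi n i o) + F n ^+ 2).
      by apply: bounded_rvD => //; exact: bounded_rv_cst.
    rewrite RexpZ; last exact: bounded_rvD.
    rewrite RexpD// RexpD//; last exact: bounded_rv_cst.
    rewrite RexpZ// FE Rexp_cst; congr (_ * _).
    have -> : \int[P n]_o (f n (@chi n i o) ^+ 2) = F2n n.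
      rewrite /F2n /obs_mean fine_expectation.
      apply: (@Rexp_identically_distributed _ _ _ (P n) _ (@chi n)
        (fun x => f n x ^+ 2)) => //.
      exact: bounded_rvX.
    ring.
  under eq_bigr do rewrite gi.
  rewrite sumr_const card_ord -[LHS]mulr_natl -sp2; field.
  by rewrite D0 gt_eqF.
apply: cvgM; last exact: cvg_cst.
apply: cvgB; first exact: F2_cvg.
by rewrite expr2; under eq_fun do rewrite expr2; exact: cvgM.
Qed.

Let dltE n o : @mean n o - H n (sg n) = D * @W n o / sp n + b n.
Proof.
rewrite /W /g -mulr_suml sumrB sumr_const card_ord /mean /b.
rewrite -[F n *+ _]mulr_natr -sp2; field.
by rewrite D0 gt_eqF.
Qed.

Let est_local (eta : R) : 0 < eta -> exists2 r : R, 0 < r &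
  \forall n \near \oo, forall o : T n,
    `|D * W o / sp n + b n| <= r ->
    `|est o - sg n - (D * W o / sp n + b n) / D| <=
      eta * `|D * W o / sp n + b n|.
Proof.
move=> eta0.
have [r r0 rP] := closest_zero_local t_gt0 sigma_gt0 t_cvg sg_cvg dH D0 dHD eta0.
exists r => //; apply: filterS rP => n rP o.
rewrite -dltE => /rP; rewrite /est.
have -> // : (fun u => H n (sg n) + (mean o - H n (sg n)) - H n u) =
    (fun u => mean o - H n u).
by apply/funext => u; ring.
Qed.

Let mmean n : measurable_fun [set: T n] (@mean n).
Proof.
apply: measurable_funM; first exact: measurable_cst.
by have [] : bounded_rv (fun o => \sum_i f n (@chi n i o)) by exact: bounded_rv_sum.
Qed.

Let cH n (u : R) : 0 < u -> {for u, continuous (H n)}.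
Proof.
move=> u0; apply: differentiable_continuous.
by apply/derivable1_diffP; exact: dH.
Qed.

Let mest n : measurable_fun [set: T n] (@est n).
Proof.
apply: (@measurable_closest_zero _ _ _ (fun o u => mean o - H n u) (fun=> t n)).
- move=> c mc c0; apply: measurable_funB => //.
  have opos : open [set u : R | 0 < u] by exact: open_gt.
  apply: (@measurable_comp _ _ _ _ _ _ [set u : R | 0 < u]) => //.
  + exact: open_measurable.
  + by move=> _ [x _ <-] /=.
  + apply: open_continuous_measurable_fun => // u /set_mem u0.
    exact: cH.
- by move=> o u u0; apply: cvgB; [exact: cvg_cst|exact: cH].
- exact: measurable_cst.
- by move=> _; exact: t_gt0.
Qed.

(** While |W| stays below [K], the rescaled error is bounded independently of [n], hence eventually
    by [k n]; Chebyshev's inequality controls the rest. In the minimum, [sp n] pays for the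
    fluctuation and [w n] for the bias. *)
Lemma Rexp_indic_estimator_tail (k : nat -> nat) : k @ \oo --> \oo ->
  \int[P n]_o (\1_[set y | (k n)%:R < `|y|]
    (Num.min (w n) (sp n) * (@est n o - sg n)) : R) @[n --> \oo] --> 0.
Proof.
move=> k_oo; apply/cvgr0Pnorm_le => e e0.
have nD : 0 < `|D| by rewrite normr_gt0.
have v0 : 0 <= v.
  apply: (cvgr_to_ge V_cvg); apply: nearW => n.
  by apply: Rintegral_ge0 => o _; exact: sqr_ge0.
(* Chosen so that [v + 1 <= e * K <= e * K ^+ 2], where [v + 1] eventually bounds [V n]. *)
pose K := (v + 1) / e + 1.
have K1 : 1 <= K by rewrite lerDr divr_ge0 ?addr_ge0// ltW.
have K0 : 0 < K by exact: lt_le_trans K1.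
have [r r0 rP] := est_local ltr01.
(* With relative error 1 in the linearization, |est - sg| is at most |dlt| + |dlt| / |D|. *)
pose c := 1 + `|D|^-1.
have c0 : 0 < c by rewrite addr_gt0// invr_gt0.
have k_oo' : (k n)%:R @[n --> \oo] --> (+oo%R : set_system R) by exact/cvgrnyP.
near=> n.
have w0 : 0 < w n by near: n; move/cvgryPgt : w_oo; exact.
have kc : c * (`|D| * K + `|Cb|) <= (k n)%:R.
  by near: n; move/cvgryPge : k_oo'; exact.
have sr : `|D| * K / (r / 2) <= sp n by near: n; move/cvgryPge : sp_oo; exact.
have br : `|b n| <= r / 2.
  by near: n; move/cvgr0Pnorm_le : b_cvg; apply; rewrite divr_gt0.
have Vn : V n <= v + 1 by near: n; apply: (cvgr_le _ V_cvg); rewrite ltrDl.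
have near_n : forall o : T n, `|D * W o / sp n + b n| <= r ->
    `|est o - sg n - (D * W o / sp n + b n) / D| <=
    1 * `|D * W o / sp n + b n|.
  by near: n; exact: rP.
pose m := Num.min (w n) (sp n).
have m0 : 0 < m by rewrite lt_min w0 spp.
have pt o : `|\1_[set y | (k n)%:R < `|y|] (m * (@est n o - sg n)) : R| <=
    (K ^+ 2)^-1 * @W n o ^+ 2.
  rewrite indicE; have [WK|KW] := ltP `|@W n o| K; last first.
    apply: (@le_trans _ _ 1); first by case: (_ \in _); rewrite ?normr1 ?normr0.
    rewrite mulrC ler_pdivlMr ?exprn_gt0// mul1r -(real_normK (num_real (W o))).
    by rewrite lerXn2r ?nnegrE// ltW.
  rewrite memNset ?normr0; first by rewrite mulr_ge0 ?invr_ge0 ?sqr_ge0.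
  apply/negP; rewrite /= -leNgt.
  set dlt := D * W o / sp n + b n.
  have DW : `|D * W o| <= `|D| * K by rewrite normrM ler_pM2l// ltW.
  have dltr : `|dlt| <= r.
    rewrite (le_trans (ler_normD _ _))// [leRHS](splitr r) lerD//.
    rewrite normrM normfV (gtr0_norm (spp n)) ler_pdivrMr//.
    by rewrite (le_trans DW)// [leRHS]mulrC -ler_pdivrMr// divr_gt0.
  have est_le : `|@est n o - sg n| <= c * `|dlt|.
    have -> : est o - sg n = (est o - sg n - dlt / D) + dlt / D by ring.
    rewrite (le_trans (ler_normD _ _))// /c [leRHS]mulrDl lerD//.
      exact: near_n.
    by rewrite normrM normfV mulrC.
  rewrite normrM (gtr0_norm m0); apply: le_trans kc.
  apply: (@le_trans _ _ (m * (c * `|dlt|))); first by rewrite ler_pM2l.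
  rewrite mulrCA ler_pM2l//.
  apply: (@le_trans _ _ (m * (`|D * W o| / sp n) + m * `|b n|)).
    rewrite -mulrDr ler_pM2l// (le_trans (ler_normD _ _))// lerD2r.
    by rewrite normrM normfV (gtr0_norm (spp n)).
  rewrite lerD//.
    apply: le_trans DW; rewrite mulrCA ler_piMr// ler_pdivrMr// mul1r.
    by rewrite ge_min lexx orbT.
  rewrite (le_trans _ (ler_norm _))// (le_trans _ (w_bias n))//.
  by rewrite ler_wpM2r// ge_min lexx.
have mset : measurable [set y : R | (k n)%:R < `|y|].
  have mc : measurable_fun [set: R] (fun=> (k n)%:R : R) by exact: measurable_cst.
  exact: (measurable_set_ltr mc (@normr_measurable R setT)).
have bI : bounded_rv (fun o => \1_[set y | (k n)%:R < `|y|]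
    (m * (@est n o - sg n)) : R).
  apply: (bounded_rv_comp (k := \1_[set y | (k n)%:R < `|y|]) (B := 1)).
  - exact: measurable_indic.
  - by move=> y; rewrite indicE; case: (_ \in _); rewrite ?normr1 ?normr0.
  - apply: measurable_funM; first exact: measurable_cst.
    by apply: measurable_funB => //; exact: measurable_cst.
have bW2 := bounded_rvX 2 (bW n).
apply: (@le_trans _ _ (\int[P n]_o ((K ^+ 2)^-1 * @W n o ^+ 2))).
  apply: le_norm_Rexp => //.
  by apply: bounded_rvM => //; exact: bounded_rv_cst.
rewrite RexpZ// mulrC ler_pdivrMr ?exprn_gt0// (le_trans Vn)//.
apply: (@le_trans _ _ (e * K)).
  by rewrite /K mulrDr mulrCA divff ?gt_eqF// !mulr1 lerDl ltW.
by rewrite ler_pM2l// expr2 ler_peMl// ltW.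
Unshelve. all: by end_near. Qed.

(** A Slutsky argument: the rescaled error differs from [W] by little on the event that |W| is at
    most [K]. The bias disappears because [sp n * b n] is the bounded quantity [w n * b n] divided
    by a ratio that tends to infinity. *)
Lemma cvg_Rexp_estimator (h : R -> R) (B : R) :
  w n / sp n @[n --> \oo] --> +oo ->
  continuous h -> (forall x, `|h x| <= B) ->
  \int[P n]_o h (sp n * (@est n o - sg n)) @[n --> \oo] -->
  \int[centered_normal v]_x h x.
Proof.
move=> wsp_oo ch hB.
have B0 : 0 <= B by rewrite (le_trans _ (hB 0)).
have nD : 0 < `|D| by rewrite normr_gt0.
have v0 : 0 <= v.
  apply: (cvgr_to_ge V_cvg); apply: nearW => n.
  by apply: Rintegral_ge0 => o _; exact: sqr_ge0.
have mh : measurable_fun [set: R] h by exact: continuous_measurable_fun.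
have hW := clt mchi indep_chi mg gdl dl_cvg g0 V_cvg ch hB.
suff diff : \int[P n]_o h (sp n * (@est n o - sg n)) -
    \int[P n]_o h (@W n o) @[n --> \oo] --> 0.
  rewrite -[X in _ --> X]add0r.
  have -> : (fun n => \int[P n]_o h (sp n * (@est n o - sg n))) =
      (fun n => \int[P n]_o h (sp n * (@est n o - sg n)) -
        \int[P n]_o h (@W n o) + \int[P n]_o h (@W n o)).
    by apply/funext => n; rewrite subrK.
  exact: cvgD.
apply/cvgr0Pnorm_le => e e0.
(* Eventually [1 + V n <= v + 2], so the modulus term contributes at most [e / 2]. *)
pose eps := e / (2 * (v + 2)).
have v2 : 0 < v + 2 by rewrite ltr_wpDl.
have eps0 : 0 < eps by rewrite divr_gt0// mulr_gt0.
have [dh [dh0 modh]] := bounded_continuous_modulus ch hB eps0.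
(* Makes the Chebyshev term [2 * B * (v + 1) / K ^+ 2] at most [e / 2]. *)
pose K := 4 * B * (v + 1) / e + 1.
have K1 : 1 <= K by rewrite lerDr divr_ge0 ?(ltW e0)// !mulr_ge0 ?addr_ge0.
have K0 : 0 < K by exact: lt_le_trans K1.
(* The rescaled [dlt] is at most [|D| * K + 1], so the linearization error is at most [dh / 2]. *)
pose eta := dh / (2 * (`|D| * K + 1)).
have DK1 : 0 < `|D| * K + 1 by rewrite ltr_wpDl// mulr_ge0 ?ltW.
have eta0 : 0 < eta by rewrite divr_gt0// mulr_gt0.
have [r r0 rP] := est_local eta0.
(* The bound 1 enters the estimate of the rescaled [dlt]; the other leaves [dh / 2] after the bias
   is divided by [D]. *)
pose beta := Num.min 1 (dh * `|D| / 2).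
have beta0 : 0 < beta by rewrite lt_min ltr01 divr_gt0// mulr_gt0.
near=> n.
have w0 : 0 < w n by near: n; move/cvgryPgt : w_oo; exact.
have sr : `|D| * K / (r / 2) <= sp n by near: n; move/cvgryPge : sp_oo; exact.
have br : `|b n| <= r / 2.
  by near: n; move/cvgr0Pnorm_le : b_cvg; apply; rewrite divr_gt0.
have Vn : V n <= v + 1 by near: n; apply: (cvgr_le _ V_cvg); rewrite ltrDl.
have V0 : 0 <= V n by apply: Rintegral_ge0 => o _; exact: sqr_ge0.
have wsp : (`|Cb| + 1) / beta <= w n / sp n.
  by near: n; move/cvgryPge : wsp_oo; exact.
have spb : sp n * `|b n| <= beta.
  have wsp0 : 0 < w n / sp n by rewrite divr_gt0.
  rewrite -(ler_pM2l wsp0) mulrA divfK ?gt_eqF// (le_trans (w_bias n))//.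
  move: wsp; rewrite ler_pdivrMr// => /(le_trans _); apply.
  by rewrite (le_trans (ler_norm _))// lerDl.
have near_n : forall o : T n, `|D * W o / sp n + b n| <= r ->
    `|est o - sg n - (D * W o / sp n + b n) / D| <=
    eta * `|D * W o / sp n + b n|.
  by near: n; exact: rP.
have close o : `|@W n o| <= K ->
    `|sp n * (@est n o - sg n) - @W n o| <= dh.
  move=> WK; have DW : `|D * W o| <= `|D| * K by rewrite normrM ler_pM2l.
  set dlt := D * W o / sp n + b n.
  have dltr : `|dlt| <= r.
    rewrite (le_trans (ler_normD _ _))// [leRHS](splitr r) lerD//.
    rewrite normrM normfV (gtr0_norm (spp n)) ler_pdivrMr//.
    by rewrite (le_trans DW)// [leRHS]mulrC -ler_pdivrMr// divr_gt0.
  have spdlt : sp n * `|dlt| <= `|D| * K + 1.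
    rewrite -{1}(gtr0_norm (spp n)) -normrM /dlt mulrDr mulrCA divff ?gt_eqF//.
    rewrite mulr1 (le_trans (ler_normD _ _))// lerD//.
    rewrite normrM (gtr0_norm (spp n)) (le_trans spb)//.
    by rewrite ge_min lexx.
  have -> : sp n * (est o - sg n) - W o =
      sp n * (est o - sg n - dlt / D) + sp n * b n / D.
    by rewrite /dlt; field; rewrite D0 gt_eqF.
  rewrite (le_trans (ler_normD _ _))// [leRHS](splitr dh) lerD//.
    rewrite normrM (gtr0_norm (spp n)).
    apply: (@le_trans _ _ (eta * (sp n * `|dlt|))).
      rewrite [leRHS]mulrCA ler_pM2l//; exact: near_n.
    rewrite (@le_trans _ _ (eta * (`|D| * K + 1)))// ?ler_pM2l//.
    rewrite le_eqVlt; apply/orP; left; apply/eqP; rewrite /eta; field.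
    by rewrite gt_eqF.
  rewrite normrM normfV ler_pdivrMr// normrM (gtr0_norm (spp n)).
  rewrite (le_trans spb)// ge_min; apply/orP; right.
  by rewrite mulrAC.
have bY : bounded_rv (fun o => h (sp n * (@est n o - sg n))).
  apply: (bounded_rv_comp mh hB); apply: measurable_funM.
    exact: measurable_cst.
  by apply: measurable_funB => //; exact: measurable_cst.
have bhW : bounded_rv (fun o => h (@W n o)).
  exact: (bounded_rv_comp mh hB (bW n).1).
have bW2 := bounded_rvX 2 (bW n).
have pt o : `|h (sp n * (@est n o - sg n)) - h (@W n o)| <=
    eps * (1 + @W n o ^+ 2) + 2 * B / K ^+ 2 * @W n o ^+ 2.
  have [WK|KW] := leP `|@W n o| K.
    have := modh (W o) _ (close o WK); rewrite subrKC => /le_trans; apply.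
    by rewrite lerDl mulr_ge0 ?sqr_ge0// divr_ge0 ?sqr_ge0// mulr_ge0.
  rewrite (le_trans (ler_normB _ _))// (le_trans (lerD (hB _) (hB _)))//.
  apply: (@le_trans _ _ (2 * B / K ^+ 2 * @W n o ^+ 2)); last first.
    by rewrite lerDr mulr_ge0 ?(ltW eps0)// addr_ge0 ?sqr_ge0.
  rewrite mulrAC -mulrA -mulr2n -[leLHS]mulr_natl ler_peMr ?mulr_ge0//.
  rewrite ler_pdivlMr ?exprn_gt0// mul1r -(real_normK (num_real (W o))).
  by rewrite lerXn2r ?nnegrE// ltW.
have b1 : bounded_rv (fun o : T n => 1 + @W n o ^+ 2).
  by apply: bounded_rvD => //; exact: bounded_rv_cst.
have b2 : bounded_rv (fun o : T n => eps * (1 + @W n o ^+ 2)).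
  by apply: bounded_rvM => //; exact: bounded_rv_cst.
have b3 : bounded_rv (fun o : T n => 2 * B / K ^+ 2 * @W n o ^+ 2).
  by apply: bounded_rvM => //; exact: bounded_rv_cst.
rewrite -RexpB//.
apply: (@le_trans _ _ (\int[P n]_o (eps * (1 + @W n o ^+ 2) +
    2 * B / K ^+ 2 * @W n o ^+ 2))).
  by apply: le_norm_Rexp => //; [exact: bounded_rvB|exact: bounded_rvD].
have bc1 := @bounded_rv_cst _ (T n) _ (1 : R).
rewrite (RexpD _ b2 b3) (RexpZ _ _ b1) (RexpD _ bc1 bW2) Rexp_cst (RexpZ _ _ bW2).
rewrite -/(V n) [leRHS](splitr e) lerD//.
  rewrite /eps mulrAC ler_pdivrMr ?mulr_gt0//.
  have -> : e / 2 * (2 * (v + 2)) = e * (v + 2) by field.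
  by rewrite ler_pM2l//; lra.
rewrite mulrAC ler_pdivrMr ?exprn_gt0//.
apply: (@le_trans _ _ (2 * B * (v + 1))).
  by rewrite ler_wpM2l// mulr_ge0.
apply: (@le_trans _ _ (e / 2 * K)).
  have -> : e / 2 * K = 2 * B * (v + 1) + e / 2.
    by rewrite /K; field; rewrite gt_eqF.
  by rewrite lerDl divr_ge0// ltW.
rewrite ler_pM2l ?divr_gt0// expr2 ler_peMl// ltW//.
Unshelve. all: by end_near. Qed.

End deterministic_parameters.

(** * The estimator at random parameters *)

(* [f s] and [H s] are unconstrained for [s <= 0]; composing with [pos_or1] makes
   the estimator a total measurable function of [s]. *)
Definition pos_or1 (R : realType) (x : R) : R := if 0 < x then x else 1.

Lemma pos_or1_gt0 (R : realType) (x : R) : 0 < pos_or1 x.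
Proof. by rewrite /pos_or1; case: ifPn. Qed.

Lemma pos_or1E (R : realType) (x : R) : 0 < x -> pos_or1 x = x.
Proof. by rewrite /pos_or1 => ->. Qed.

Lemma measurable_pos_or1 (R : realType) :
  measurable_fun [set: R] (@pos_or1 R).
Proof.
apply: measurable_fun_ifT; first exact: measurable_fun_ltr.
- exact: measurable_id.
- exact: measurable_cst.
Qed.

Lemma estimating_funE (R : realType) (T : Type) m (chi : 'I_m -> T -> R)
    (f : R -> R -> R -> R) (H : R -> R -> R) s q o : (0 < m)%N ->
  estimating_fun chi f H s q o =
  fun u => m%:R^-1 * \sum_i f s q (chi i o) - H s u.
Proof.
move=> m0; apply/funext => u; rewrite /estimating_fun sumrB mulrBr.
by rewrite sumr_const card_ord -[H s u *+ m]mulr_natl mulKf// pnatr_eq0 -lt0n.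
Qed.

Section random_estimator.
Context (R : realType) (d : measure_display) (T : measurableType d)
  (P : probability T R) (m : nat) (chi : 'I_m -> T -> R) (S Q : T -> R)
  (f : R -> R -> R -> R) (H : R -> R -> R).
Hypothesis m_gt0 : (0 < m)%N.
Hypothesis mchi : forall i, measurable_fun [set: T] (chi i).
Hypothesis mS : measurable_fun [set: T] S.
Hypothesis mQ : measurable_fun [set: T] Q.
Hypothesis S_gt0 : forall o, 0 < S o.
Hypothesis indep : independent_pair_family P S Q chi.
Hypothesis mf : measurable_fun [set z : R * R * R | 0 < z.1.2]
  (fun z : R * R * R => f z.1.2 z.2 z.1.1).
Hypothesis mH : measurable_fun [set z : R * R | 0 < z.1 /\ 0 < z.2]
  (fun z : R * R => H z.1 z.2).
Hypothesis dH : forall s u : R, 0 < s -> 0 < u -> derivable (H s) u 1.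

Let SQ o := (S o, Q o).
Let X o := [tuple chi i o | i < m].

Let mSQ : measurable_fun [set: T] SQ.
Proof. exact: measurable_fun_pair. Qed.

Let mX : measurable_fun [set: T] X.
Proof.
apply/measurable_fun_tnthP => i.
rewrite (_ : _ \o _ = chi i)//.
by apply/funext => o /=; rewrite tnth_mktuple.
Qed.

(** Independence is given for generated sigma-algebras; these consist of the preimages under the
    pair and under the tuple, the form needed for the product law. *)
Let indep_SQX A B : measurable A -> measurable B ->
  P (SQ @^-1` A `&` X @^-1` B) = (P (SQ @^-1` A) * P (X @^-1` B))%E.
Proof.
move=> mA mB; apply: indep.
  rewrite -[S]/(fst \o SQ) -[Q]/(snd \o SQ) g_sigma_preimageU_comp.
  by exists A => //; rewrite setTI.
have -> : chi = fun i => (@tnth m R)^~ i \o X.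
  by apply/funext => i; apply/funext => o /=; rewrite tnth_mktuple.
rewrite g_sigma_preimage_comp.
by exists B => //; rewrite setTI.
Qed.

(** The estimator as a function on a product space, with the coordinates of a tuple as observations,
    so that parameters and data can be integrated separately. *)
Let est (z : (R * R) * m.-tuple R) : R :=
  sigma_hat (fun i (x : m.-tuple R) => tnth x i) f H (pos_or1 z.1.1) z.1.2 z.2.

Let estE z o : est (z, X o) = sigma_hat chi f H (pos_or1 z.1) z.2 o.
Proof.
rewrite /est /sigma_hat !estimating_funE//; congr (xget _ (closest_zero _ _)).
apply/funext => u; congr (_ * _ - _).
by apply: eq_bigr => i _; rewrite tnth_mktuple.
Qed.

Let mest : measurable_fun setT est.
Proof.
pose mean (z : (R * R) * m.-tuple R) : R :=
  m%:R^-1 * \sum_i f (pos_or1 z.1.1) z.1.2 (tnth z.2 i).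
pose U (z : (R * R) * m.-tuple R) (u : R) : R := mean z - H (pos_or1 z.1.1) u.
have -> : est = fun z => xget 1 (closest_zero (U z) (pos_or1 z.1.1)).
  by apply/funext => z; rewrite /est /sigma_hat estimating_funE.
have ms : measurable_fun setT
    (fun z : (R * R) * m.-tuple R => pos_or1 z.1.1).
  apply: measurableT_comp; first exact: measurable_pos_or1.
  by apply: measurableT_comp => //; exact: measurable_fst.
have mq : measurable_fun setT (fun z : (R * R) * m.-tuple R => z.1.2).
  by apply: measurableT_comp => //; exact: measurable_fst.
have mfi i : measurable_fun setT (fun z : (R * R) * m.-tuple R =>
    f (pos_or1 z.1.1) z.1.2 (tnth z.2 i)).
  apply: (@measurable_comp _ _ _ _ _ _ [set z : R * R * R | 0 < z.1.2]
    (fun z : R * R * R => f z.1.2 z.2 z.1.1) setT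
    (fun z => ((tnth z.2 i, pos_or1 z.1.1), z.1.2))) => //.
  - have m12 : measurable_fun setT (fun z : R * R * R => z.1.2).
      by apply: measurableT_comp => //; exact: measurable_fst.
    have m0 : measurable_fun setT (fun _ : R * R * R => 0 : R).
      exact: measurable_cst.
    exact: (measurable_set_ltr m0 m12).
  - by move=> _ [z _ <-] /=; exact: pos_or1_gt0.
  - apply: measurable_fun_pair => //; apply: measurable_fun_pair => //.
    apply: (@measurableT_comp _ _ _ _ _ _ (fun x : m.-tuple R => tnth x i)).
      exact: measurable_tnth.
    exact: measurable_snd.
have mmean : measurable_fun setT mean.
  apply: measurable_funM; first exact: measurable_cst.
  exact: measurable_sum.
apply: measurable_closest_zero => //; last by move=> z; exact: pos_or1_gt0.
- move=> c mc c0; apply: measurable_funB => //.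
  apply: (@measurable_comp _ _ _ _ _ _ [set z : R * R | 0 < z.1 /\ 0 < z.2]
    (fun z : R * R => H z.1 z.2) setT
    (fun z => (pos_or1 z.1.1, c z))) => //.
  - have m0 : measurable_fun setT (fun _ : R * R => 0 : R).
      exact: measurable_cst.
    have -> : [set z : R * R | 0 < z.1 /\ 0 < z.2] =
        [set z : R * R | 0 < z.1] `&` [set z : R * R | 0 < z.2] by [].
    apply: measurableI.
      exact: (measurable_set_ltr m0 measurable_fst).
    exact: (measurable_set_ltr m0 measurable_snd).
  - by move=> _ [z _ <-] /=; split=> //; exact: pos_or1_gt0.
  - exact: measurable_fun_pair.
- move=> z u u0; apply: cvgB; first exact: cvg_cst.
  apply: differentiable_continuous; apply/derivable1_diffP.
  by apply: dH => //; exact: pos_or1_gt0.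
Qed.

Lemma measurable_sigma_hat :
  measurable_fun [set: T] (fun o => sigma_hat chi f H (S o) (Q o) o).
Proof.
have -> : (fun o => sigma_hat chi f H (S o) (Q o) o) =
    est \o (fun o => (SQ o, X o)).
  by apply/funext => o; rewrite /= estE /= (pos_or1E (S_gt0 o)).
by apply: measurableT_comp => //; exact: measurable_fun_pair.
Qed.

Variables (k : R -> R) (B : R).
Hypothesis mk : measurable_fun [set: R] k.
Hypothesis kB : forall x, `|k x| <= B.

Let G (z : R * R) := \int[P]_o k (sigma_hat chi f H (pos_or1 z.1) z.2 o).

Let K z := k (est z).

Let bK : bounded_rv K.
Proof. exact: (bounded_rv_comp mk kB mest). Qed.

Let GE z : G z = \int[P]_o K (z, X o).
Proof. by apply: eq_Rintegral => o _; rewrite /K estE. Qed.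

Let bG : bounded_rv G.
Proof.
have -> : G = fun z => \int[P]_o K (z, X o) by apply/funext.
exact: (bounded_rv_partial P mSQ mX bK).
Qed.

Lemma bounded_rv_Rexp_sigma_hat : bounded_rv (fun o => G (S o, Q o)).
Proof.
have [mG [B' GB']] := bG.
by apply: (@bounded_rvW _ _ _ B') => //; exact: (measurableT_comp mG mSQ).
Qed.

Lemma norm_Rexp_sigma_hat z : `|G z| <= B.
Proof.
rewrite GE; apply: le_norm_Rexp_cst; last by move=> o; exact: kB.
apply: (@bounded_rvW _ _ _ B); last by move=> o; exact: kB.
by apply: (measurableT_comp bK.1); exact: measurable_fun_pair.
Qed.

Lemma Rexp_sigma_hat :
  \int[P]_o k (sigma_hat chi f H (S o) (Q o) o) = \int[P]_o G (S o, Q o).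
Proof.
transitivity (\int[P]_o K (SQ o, X o)).
  by apply: eq_Rintegral => o _; rewrite /K estE /= (pos_or1E (S_gt0 o)).
rewrite (Rexp_indep mSQ mX indep_SQX bK).
by apply: eq_Rintegral => o _; rewrite GE.
Qed.

End random_estimator.

(** * Quantitative forms of the hypotheses, and the theorem *)

Lemma uniform_cvg_near (R : realType) (V : set R) (g : nat -> R -> R)
    (h : R -> R) (e : R) : {uniform V, g @ \oo --> h} -> 0 < e ->
  \forall n \near \oo, forall u, V u -> `|g n u - h u| <= e.
Proof.
move=> gh e0.
have : nbhs (h : {uniform` V -> R}) [set g | forall u, V u -> `|g u - h u| <= e].
  apply/uniform_nbhs; exists [set xy : R * R | ball xy.1 e xy.2]; split.
    exact: entourage_ball (PosNum e0).
  by move=> g' /= h' u /h'; rewrite /ball/= distrC => /ltW.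
by move=> /gh.
Qed.

(** Continuity of [h] at [sigma] is inherited from one fixed [g N]: passing from [g n u] to
    [h sigma] through [h u], [g N u] and [g N sigma] costs four errors of [e / 4]. Applied to
    derivatives, this covers the limit [Fbar], which is only assumed differentiable. *)
Lemma locally_uniform_cvg_ball (R : realType) (g : nat -> R -> R) (h : R -> R)
    (sigma e : R) : 0 < sigma ->
  (forall n (u : R), 0 < u -> {for u, continuous (g n)}) ->
  locally_uniform_cvg g h -> 0 < e ->
  exists2 rho : R, 0 < rho & \forall n \near \oo, forall u,
    `|u - sigma| <= rho -> `|g n u - h sigma| <= e.
Proof.
move=> sigma0 cg luc e0; have e4 : 0 < e / 4 by rewrite divr_gt0.
have [V [nV _ uV]] := luc _ sigma0.
have near_V := uniform_cvg_near uV e4.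
have [N _ /(_ N (leqnn N)) /= gN] := near_V.
have /nbhs_ballP[r1 /= r10 r1V] := nV.
have /cvgrPdist_le/(_ _ e4)/nbhs_ballP[r2 /= r20 r2P] := cg N _ sigma0.
pose r := Num.min r1 r2; have r0 : 0 < r by rewrite lt_min r10 r20.
exists (r / 2); first by rewrite divr_gt0.
apply: filterS near_V => n gn u ur.
have ur' : `|sigma - u| < r.
  by rewrite distrC (le_lt_trans ur)// ltr_pdivrMr// ltr_pMr// ltr1n.
have Vu : V u by apply: r1V; rewrite /ball/= (lt_le_trans ur')// ge_min lexx.
have Vs : V sigma by exact: nbhs_singleton.
have h1 := gn u Vu; have h2 := gN u Vu; have h3 := gN sigma Vs.
have h4 : `|g N sigma - g N u| <= e / 4.
  by apply: r2P; rewrite /ball/= (lt_le_trans ur')// ge_min lexx orbT.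
have -> : g n u - h sigma = ((g n u - h u) - (g N u - h u)) -
    ((g N sigma - g N u) - (g N sigma - h sigma)) by ring.
have -> : e = (e / 4 + e / 4) + (e / 4 + e / 4) by field.
by rewrite (le_trans (ler_normB _ _))// lerD// (le_trans (ler_normB _ _))// lerD.
Qed.

Lemma supnorm_bound (R : realType) (f : nat -> R -> R -> R -> R)
    (p : nat -> nat) : (forall n, (0 < p n)%N) ->
  (ereal_sup [set y | exists n (s q : R), (0 < s)%R /\
    y = supnorm (f n s q) ^+ 4 * ((p n)%:R^-1)%:E] < +oo)%E ->
  exists C : R, forall n (s q x : R), 0 < s -> `|f n s q x| ^+ 4 <= C * (p n)%:R.
Proof.
move=> p_gt0; set A := [set _ | _]; set M := ereal_sup A => Moo.
exists (fine M) => n s q x s0.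
have pn : 0 < (p n)%:R :> R by rewrite ltr0n.
have fx_sup : ((`|f n s q x|)%:E <= supnorm (f n s q))%E.
  by apply: ereal_sup_ubound; exists x.
have fx4 : ((`|f n s q x| ^+ 4)%:E <= supnorm (f n s q) ^+ 4)%E.
  have fx0 : (0 <= (`|f n s q x|)%:E)%E by rewrite lee_fin.
  rewrite EFin_expe; elim: 4%N => [|i IH]; first by rewrite !expe0.
  rewrite !expeS; apply: lee_pmul => //.
  by apply: expe_ge0.
have le_M : ((`|f n s q x| ^+ 4 / (p n)%:R)%:E <= M)%E.
  apply: (@le_trans _ _ (supnorm (f n s q) ^+ 4 * ((p n)%:R^-1)%:E)%E).
    by rewrite EFinM lee_wpmul2r// lee_fin invr_ge0 ltW.
  by apply: ereal_sup_ubound; exists n, s, q.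
rewrite -ler_pdivrMr// -lee_fin fineK// fin_numE.
apply/andP; split; last by rewrite lt_eqF.
by rewrite gt_eqF// (lt_le_trans _ le_M)// ltNyr.
Qed.

Theorem theorem2 (R : realType)
  (p : nat -> nat) (p_gt0 : forall n, (0 < p n)%N) (p_oo : p @ \oo --> \oo)
  (d : nat -> measure_display) (Om : forall n, measurableType (d n))
  (P : forall n, R -> probability (Om n) R)
  (chi : forall n, 'I_(p n) -> {mfun Om n >-> R})
  (S Q : forall n, {mfun Om n >-> R})
  (S_gt0 : forall n w, 0 < S n w)
  (chi_indep : forall n (sig : R), 0 < sig -> mutually_independent (P n sig) (chi n))
  (chi_id : forall n (sig : R), 0 < sig ->
    identically_distributed (P n sig) (chi n))
  (SQ_chi_indep : forall n (sig : R), 0 < sig ->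
    independent_pair_family (P n sig) (S n) (Q n) (chi n))
  (f : nat -> R -> R -> R -> R) (H : nat -> R -> R -> R)
  (mf : forall n, measurable_fun [set z : R * R * R | 0 < z.1.2]
    (fun z : R * R * R => f n z.1.2 z.2 z.1.1))
  (mH : forall n, measurable_fun [set z : R * R | 0 < z.1 /\ 0 < z.2]
    (fun z : R * R => H n z.1 z.2))
  (A1 : forall (sig : nat -> R) (sigma : R), cvg_pos sig sigma ->
    cvg_in_probability (fun n => P n (sig n)) S sigma)
  (A2 : forall (sig : nat -> R) (sigma : R), cvg_pos sig sigma ->
    tight_laws (fun n => P n (sig n)) Q)
  (B1 : (ereal_sup [set y | exists n (s q : R), (0 < s)%R /\
    y = supnorm (f n s q) ^+ 4 * ((p n)%:R^-1)%:E] < +oo)%E)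
  (B2 : forall n (s : R), 0 < s -> forall u : R, 0 < u ->
    derivable (H n s) u 1 /\ {for u, continuous (derive1 (H n s))})
  (Fbar : R -> R -> R)
  (B3 : forall s : R, 0 < s ->
    (forall u : R, 0 < u -> derivable (Fbar s) u 1) /\
    forall t : nat -> R, cvg_pos t s ->
      locally_uniform_cvg (fun n => H n (t n)) (Fbar s) /\
      locally_uniform_cvg (fun n => derive1 (H n (t n))) (derive1 (Fbar s)))
  (B4 : forall s : R, 0 < s -> derive1 (Fbar s) s != 0)
  (F2 : R -> R)
  (B5 : forall (t v q : nat -> R) (u : R), cvg_pos v u -> cvg_pos t u ->
    bounded_fun q ->
    obs_mean (P n (v n)) (p_gt0 n) (chi n) (fun x => f n (t n) (q n) x ^+ 2)
      @[n --> \oo] --> F2 u)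
  (w : nat -> R) (w_oo : w n @[n --> \oo] --> +oo)
  (B6 : forall (t v q : nat -> R) (u : R), cvg_pos v u -> cvg_pos t u ->
    bounded_fun q ->
    has_ubound (range (fun n => w n *
      `|obs_mean (P n (v n)) (p_gt0 n) (chi n) (f n (t n) (q n))
        - H n (t n) (v n)|))) :
  (forall (sig : nat -> R) (sigma : R), cvg_pos sig sigma ->
    tight_laws (fun n => P n (sig n))
      (fun n om => Num.min (w n) (Num.sqrt (p n)%:R) *
         (sigma_hat (chi n) (f n) (H n) (S n om) (Q n om) om - sig n)))
  /\
  (w n / Num.sqrt (p n)%:R @[n --> \oo] --> +oo ->
   forall (sig : nat -> R) (sigma : R), cvg_pos sig sigma ->
    cvg_in_law (fun n => P n (sig n))
      (fun n om => Num.sqrt (p n)%:R *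
         (sigma_hat (chi n) (f n) (H n) (S n om) (Q n om) om - sig n))
      (centered_normal
         ((F2 sigma - Fbar sigma sigma ^+ 2) / derive1 (Fbar sigma) sigma ^+ 2))).
Proof.
have [C fC] := supnorm_bound p_gt0 B1.
have mchi n i : measurable_fun [set: Om n] (chi n i) by [].
have dH n (s u : R) : 0 < s -> 0 < u -> derivable (H n s) u 1.
  by move=> s0 u0; have [] := B2 n s s0 u u0.
have cH n (s u : R) : 0 < s -> 0 < u -> {for u, continuous (H n s)}.
  move=> s0 u0; apply: differentiable_continuous.
  by apply/derivable1_diffP; exact: dH.
have mfs n (s q : R) : 0 < s -> measurable_fun [set: R] (f n s q).
  move=> s0.
  apply: (@measurable_comp _ _ _ _ _ _ [set z : R * R * R | 0 < z.1.2]
    (fun z : R * R * R => f n z.1.2 z.2 z.1.1) setT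
    (fun x => ((x, s), q))) => //.
  - have m12 : measurable_fun setT (fun z : R * R * R => z.1.2).
      by apply: measurableT_comp => //; exact: measurable_fst.
    have m0 : measurable_fun setT (fun _ : R * R * R => 0 : R).
      exact: measurable_cst.
    exact: (measurable_set_ltr m0 m12).
  - by move=> _ [x _ <-].
  - apply: measurable_fun_pair; last exact: measurable_cst.
    by apply: measurable_fun_pair => //; exact: measurable_cst.
have msig n := measurable_sigma_hat (p_gt0 n) (mchi n)
  (@measurable_funPT _ _ _ _ (S n)) (@measurable_funPT _ _ _ _ (Q n))
  (@S_gt0 n) (mf n) (mH n) (dH n).
pose est n (t q : R) om := sigma_hat (chi n) (f n) (H n) t q om.
(* Both conclusions for deterministic parameters [t] and [q], already phrased as limits of
   expectations of bounded functions of the estimator. *)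
have det (sig : nat -> R) (sigma : R) (t q : nat -> R) :
    cvg_pos sig sigma -> cvg_pos t sigma -> bounded_fun q ->
    (forall k : nat -> nat, k @ \oo --> \oo ->
      \int[P n (sig n)]_om (\1_[set y | (k n)%:R < `|y|]
        (Num.min (w n) (Num.sqrt (p n)%:R) * (est n (t n) (q n) om - sig n)) : R)
        @[n --> \oo] --> 0) /\
    (w n / Num.sqrt (p n)%:R @[n --> \oo] --> +oo ->
     forall (h : R -> R) (B : R), continuous h -> (forall x, `|h x| <= B) ->
      \int[P n (sig n)]_om
        h (Num.sqrt (p n)%:R * (est n (t n) (q n) om - sig n))
        @[n --> \oo] -->
      \int[centered_normal ((F2 sigma - Fbar sigma sigma ^+ 2) /
        derive1 (Fbar sigma) sigma ^+ 2)]_x h x).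
  move=> csig ct bq.
  have [sig_gt0 sigma_gt0 sig_cvg] := csig; have [t_gt0 _ t_cvg] := ct.
  have [dFbar /(_ t ct)[luH ludH]] := B3 sigma sigma_gt0.
  have [Cb CbP] := B6 t sig q sigma csig ct bq.
  have w_bias n : w n * `|obs_mean (P n (sig n)) (p_gt0 n) (chi n)
      (f n (t n) (q n)) - H n (t n) (sig n)| <= Cb.
    by apply: CbP; exists n.
  have dHD (e : R) : 0 < e -> exists2 rho : R, 0 < rho &
      \forall n \near \oo, forall u, `|u - sigma| <= rho ->
        `|derive1 (H n (t n)) u - derive1 (Fbar sigma) sigma| <= e.
    apply: (locally_uniform_cvg_ball sigma_gt0 _ ludH) => n u u0.
    by have [] := B2 n (t n) (t_gt0 n) u u0.
  have H_cvg : H n (t n) (sig n) @[n --> \oo] --> Fbar sigma sigma.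
    apply/cvgrPdistC_le => e e0.
    have [|rho rho0 near_H] := locally_uniform_cvg_ball sigma_gt0 _ luH e0.
      by move=> n u u0; exact: cH.
    near=> n.
    have Hn : forall u, `|u - sigma| <= rho -> `|H n (t n) u - Fbar sigma sigma| <= e.
      by near: n; exact: near_H.
    by apply: Hn; near: n; move/cvgrPdistC_le : sig_cvg; apply.
  have estE n om : est n (t n) (q n) om = xget 1 (closest_zero (fun u =>
      (p n)%:R^-1 * \sum_i f n (t n) (q n) (chi n i om) - H n (t n) u) (t n)).
    by rewrite /est /sigma_hat estimating_funE.
  have tail := Rexp_indic_estimator_tail p_oo mchi
    (fun n => chi_indep n _ (sig_gt0 n)) (fun n => chi_id n _ (sig_gt0 n))
    (fun n => mfs n _ (q n) (t_gt0 n)) (fun n x => fC n _ (q n) x (t_gt0 n))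
    t_gt0 sigma_gt0 t_cvg sig_cvg (fun n u => dH n _ u (t_gt0 n))
    (B4 _ sigma_gt0) dHD H_cvg (B5 t sig q sigma csig ct bq) w_oo w_bias.
  have law := cvg_Rexp_estimator p_oo mchi
    (fun n => chi_indep n _ (sig_gt0 n)) (fun n => chi_id n _ (sig_gt0 n))
    (fun n => mfs n _ (q n) (t_gt0 n)) (fun n x => fC n _ (q n) x (t_gt0 n))
    t_gt0 sigma_gt0 t_cvg sig_cvg (fun n u => dH n _ u (t_gt0 n))
    (B4 _ sigma_gt0) dHD H_cvg (B5 t sig q sigma csig ct bq) w_oo w_bias.
  split.
    move=> k k_oo; have := tail k k_oo.
    by under [X in _ -> X @ _ --> _]eq_fun do
      under eq_Rintegral do rewrite estE.
  move=> wsp h B ch hB; have := law h B wsp ch hB.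
  by under [X in _ -> X @ _ --> _]eq_fun do
      under eq_Rintegral do rewrite estE.
(* The test functions [kap n] vary with [n], which lets them absorb the centering, the rate and the
   tail threshold; only their bound [B] must be common. *)
have transfer (sig : nat -> R) (sigma : R) (kap : nat -> R -> R) (B L : R) :
    cvg_pos sig sigma ->
    (forall n, measurable_fun [set: R] (kap n)) ->
    (forall n x, `|kap n x| <= B) ->
    (forall t q : nat -> R, cvg_pos t sigma -> bounded_fun q ->
      \int[P n (sig n)]_om kap n (est n (t n) (q n) om) @[n --> \oo] --> L) ->
    \int[P n (sig n)]_om kap n (est n (S n om) (Q n om) om) @[n --> \oo] --> L.
  move=> csig mkap kapB kapL; have [sig_gt0 sigma_gt0 _] := csig.
  pose G n (z : R * R) :=
    \int[P n (sig n)]_om kap n (est n (pos_or1 z.1) z.2 om).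
  have -> : (fun n => \int[P n (sig n)]_om kap n (est n (S n om) (Q n om) om)) =
      (fun n => \int[P n (sig n)]_om G n (S n om, Q n om)).
    apply/funext => n.
    exact: (Rexp_sigma_hat (p_gt0 n) (mchi n)
      (@measurable_funPT _ _ _ _ (S n)) (@measurable_funPT _ _ _ _ (Q n))
      (@S_gt0 n) (SQ_chi_indep n _ (sig_gt0 n)) (mf n) (mH n) (dH n)
      (mkap n) (kapB n)).
  apply: (@cvg_Rexp_random_parameters _ _ _ (fun n => P n (sig n))
    (fun n => S n) (fun n => Q n) sigma (fun n => @measurable_funPT _ _ _ _ (S n))
    S_gt0 sigma_gt0 (A1 sig sigma csig) (A2 sig sigma csig) G L B).
  - move=> n.
    exact: (bounded_rv_Rexp_sigma_hat (P n (sig n)) (p_gt0 n) (mchi n)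
      (@measurable_funPT _ _ _ _ (S n)) (@measurable_funPT _ _ _ _ (Q n))
      (mf n) (mH n) (dH n) (mkap n) (kapB n)).
  - move=> n z.
    exact: (norm_Rexp_sigma_hat (P n (sig n)) (p_gt0 n) (mchi n)
      (mf n) (mH n) (dH n) (mkap n) (kapB n)).
  - move=> t q ct bq; have [t_gt0 _ _] := ct.
    have := kapL t q ct bq.
    rewrite /G; under [X in _ -> X @ _ --> _]eq_fun do
      under eq_Rintegral do rewrite (pos_or1E (t_gt0 _)).
    by [].
have mlin (c a : R) : measurable_fun [set: R] (fun y : R => c * (y - a)).
  apply: measurable_funM; first exact: measurable_cst.
  by apply: measurable_funB; [exact: measurable_id|exact: measurable_cst].
have mX n (c a : R) :
    measurable_fun [set: Om n] (fun om => c * (est n (S n om) (Q n om) om - a)).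
  apply: measurable_funM; first exact: measurable_cst.
  by apply: measurable_funB; [exact: msig|exact: measurable_cst].
split=> [sig sigma csig|wsp sig sigma csig].
  apply: tight_lawsP => [n|k k_oo]; first exact: mX.
  pose Z n := [set y : R | (k n)%:R < `|y|].
  have mZ n : measurable (Z n).
    have mc : measurable_fun [set: R] (fun=> (k n)%:R : R) by exact: measurable_cst.
    exact: (measurable_set_ltr mc (@normr_measurable R setT)).
  pose c n := Num.min (w n) (Num.sqrt (p n)%:R).
  (* The tail probability is the expectation of this indicator, so tightness goes through the same
     [transfer] as convergence in law. *)
  pose kap n (y : R) : R := \1_(Z n) (c n * (y - sig n)).
  have -> : (fun n => fine (P n (sig n) [set om | (k n)%:R <
      `|Num.min (w n) (Num.sqrt (p n)%:R) *
        (sigma_hat (chi n) (f n) (H n) (S n om) (Q n om) om - sig n)|])) =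
      (fun n => \int[P n (sig n)]_om kap n (est n (S n om) (Q n om) om)).
    apply/funext => n; rewrite -Rexp_indic.
      by apply: eq_Rintegral => om _; rewrite /kap !indicE; congr (_%:R);
        apply/idP/idP; rewrite !inE.
    rewrite -[X in measurable X]setTI.
    exact: (mX n (c n) (sig n) measurableT _ (mZ n)).
  apply: (@transfer sig sigma kap 1) => //.
  - move=> n; have mI : measurable_fun [set: R] (\1_(Z n) : R -> R).
      exact: measurable_indic.
    exact: (measurableT_comp mI (mlin (c n) (sig n))).
  - by move=> n x; rewrite /kap indicE; case: (_ \in _); rewrite ?normr1 ?normr0.
  - by move=> t q ct bq; exact: (det sig sigma t q csig ct bq).1.
split=> [n|h ch bh]; first exact: mX.
have [B hB] : exists B, forall x, `|h x| <= B.
  have [M [_ hM]] := bh; exists (M + 1) => x.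
  by apply: (hM (M + 1)) => //; rewrite ltrDl.
have mh : measurable_fun [set: R] h by exact: continuous_measurable_fun.
set nu := centered_normal _.
have bhnu : @bounded_rv _ (measurableTypeR R) R h by exact: (bounded_rvW mh hB).
rewrite (RexpE nu bhnu).
pose Y n om := Num.sqrt (p n)%:R * (est n (S n om) (Q n om) om - sig n).
have -> : (fun n => 'E_(P n (sig n))[h \o Y n])%E =
  (fun n => (\int[P n (sig n)]_om h (Num.sqrt (p n)%:R *
    (est n (S n om) (Q n om) om - sig n)))%:E).
  apply/funext => n; rewrite RexpE//.
  exact: (bounded_rv_comp mh hB (mX n _ _)).
apply: cvg_EFin; first exact: nearW.
apply: (@transfer sig sigma
  (fun n y => h (Num.sqrt (p n)%:R * (y - sig n))) B) => //.
- by move=> n; exact: (measurableT_comp mh (mlin _ _)).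
- move=> t q ct bq.
  exact: ((det sig sigma t q csig ct bq).2 wsp h B ch hB).
Unshelve. all: by end_near. Qed.
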